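(* Let $(T(t))_{t\ge0}$ be a $\tau$-bi-continuous semigroup with generator $(A,D(A))$ on a Banach space $X$, and let $\mathscr P$ be the set of generating continuous seminorms corresponding to $\tau$. Let $B\in\mathscr L(X,X_{-1})$ be such that $B:(X,\tau)\to(X_{-1},\tau_{-1})$ is linear and continuous, and let $t_0>0$ be such that: (a) $\int_0^{t_0}T_{-1}(t_0-r)Bf(r)\,\mathrm dr\in X$ for each $f\in \mathrm C_{\mathrm b}([0,t_0],(X,\tau))$. (b) For every $\varepsilon>0$ and every $p\in\mathscr P$ there exist $q\in\mathscr P$ and $K>0$ such that for all $f\in \mathrm C_{\mathrm b}([0,t_0],(X,\tau))$ $$p\Bigl(\int_0^{t_0}T_{-1}(t_0-r)Bf(r)\,\mathrm dr\Bigr)\le K\sup_{r\in[0,t_0]}|q(f(r))|+\varepsilon\|f\|_\infty .$$ (c) There exists $M\in(0,\tfrac12)$ such that for all $f\in \mathrm C_{\mathrm b}([0,t_0],(X,\tau))$ $$\Bigl\|\int_0^{t_0}T_{-1}(t_0-r)Bf(r)\,\mathrm dr\Bigr\|\le M\|f\|_\infty .$$ Then $B\in\mathcal S^{DS,\tau}_{t_0}$, and as a consequence the operator $(A_{-1}+B)_{|X}$ defined on the domain $$D((A_{-1}+B)_{|X}):=\{x\in X:\ A_{-1}x+Bx\in X\}$$ generates a $\tau$-bi-continuous semigroup.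
   Context: **Setting.** A triple $(X,\|\cdot\|,\tau)$ is fixed, where $X$ is a Banach space and $\tau$ is a Hausdorff locally convex topology on $X$, coarser than the norm topology, such that every norm-bounded $\tau$-Cauchy sequence is $\tau$-convergent, and $\|x\|=\sup\{|\varphi(x)|:\varphi\in(X,\tau)',\ \|\varphi\|\le1\}$ for all $x\in X$. $\mathscr{P}$ denotes a family of $\tau$-continuous seminorms generating $\tau$ with $\|x\|=\sup_{p\in\mathscr P}p(x)$. $\mathscr{L}(X)$ denotes the norm-bounded linear operators. $\mathrm C_{\mathrm b}([0,t_0],(X,\tau))$ is the space of $\|\cdot\|$-bounded, $\tau$-continuous functions $f:[0,t_0]\to X$, with $\|f\|_\infty=\sup_{r}\|f(r)\|$. Integrals of $X_{-1}$-valued functions are $\tau_{-1}$-Riemann integrals. **Bi-continuous semigroups.** A family $\mathcal B\subseteq\mathscr L(X)$ is bi-equicontinuous if for each norm-bounded $\tau$-null sequence $(x_n)$ one has $Bx_n\to0$ in $\tau$ uniformly for $B\in\mathcal B$. A family $(T(t))_{t\ge0}\subseteq\mathscr L(X)$ is a $\tau$-bi-continuous semigroup if: $T(t+s)=T(t)T(s)$, $T(0)=I$; $t\mapsto T(t)x$ is $\tau$-continuous on $[0,\infty)$ for each $x$; $\|T(t)\|\le Me^{\omega t}$ for some $M\ge1,\omega\in\mathbb R$ and all $t\ge 0$; and $\{T(t):t\in[0,s]\}$ is bi-equicontinuous for every $s>0$. Its generator is $Ax:=\tau\text{-}\lim_{t\to0}\frac{T(t)x-x}{t}$ with domain $D(A)$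 consisting of those $x\in X$ for which this $\tau$-limit exists and $\sup_{t\in(0,1]}\frac{\|T(t)x-x\|}{t}<\infty$. **Extrapolation space.** It is assumed that $0\in\rho(A)$. Let $\underline X_0:=\overline{D(A)}^{\|\cdot\|}$; the restriction of $(T(t))$ to $\underline X_0$ is a $C_0$-semigroup generated by the part $\underline A_0$ of $A$ in $\underline X_0$. Let $\underline X_{-1}$ be the completion of $\underline X_0$ for $\|x\|_{-1}=\|\underline A_0^{-1}x\|$, $\underline A_{-1}:\underline X_0\to\underline X_{-1}$ the isometric extension of $\underline A_0$, and repeat to get $\underline X_{-2}$ and $\underline A_{-2}:\underline X_{-1}\to\underline X_{-2}$. $X$ is regarded as a subspace of $\underline X_{-1}$ (via $x\mapsto\underline A_{-1}A^{-1}x$). Define $X_{-1}:=\underline A_{-2}(X)$, with norm $\|x\|_{-1}:=\|\underline A_{-2}^{-1}x\|$ and locally convex topology $\tau_{-1}$ generated by $\mathscr P_{-1}=\{p_{-1}:p\in\mathscr P\}$, $p_{-1}(x):=p(\underline A_{-2}^{-1}x)$. Put $A_{-1}:=\underline A_{-2}|_X:X\to X_{-1}$, an isomorphism both for the norms and for $\tau,\tau_{-1}$, which extends $A$; here $X\subseteq X_{-1}$ through $x=A_{-1}A^{-1}x$. The semigroup $T_{-1}(t):=A_{-1}T(t)A_{-1}^{-1}$ extends $T(t)$ to a $\tau_{-1}$-bi-continuous semigroup on $X_{-1}$ with generator $A_{-1}$, $D(A_{-1})=X$. **Admissibility.** For $t_0>0$ let $\mathfrak X_{t_0}$ be the Banach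 space of all $F:[0,t_0]\to\mathscr L(X)$ that are $\tau$-strongly continuous, norm bounded, and such that $\{F(t):t\in[0,t_0]\}$ is bi-equicontinuous, with norm $\|F\|=\sup_{t\in[0,t_0]}\|F(t)\|$. For $B\in\mathscr L(X,X_{-1})$ which is also continuous $(X,\tau)\to(X_{-1},\tau_{-1})$, define $(V_BF)(t)x:=\int_0^tT_{-1}(t-r)BF(r)x\,\mathrm dr\in X_{-1}$, for $F\in\mathfrak X_{t_0}$, $t\in[0,t_0]$, $x\in X$. Then $B\in\mathcal S^{DS,\tau}_{t_0}$ means: $(V_BF)(t)x\in X$ for all $F\in\mathfrak X_{t_0}$, $t\in[0,t_0]$, $x\in X$; $\mathrm{Ran}(V_B)\subseteq\mathfrak X_{t_0}$; and $\|V_B\|<1$ (operator norm on $\mathfrak X_{t_0}$). *)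

(* Defs.v *)
From HB Require Import structures.
From mathcomp Require Import all_boot all_order all_algebra.
From mathcomp Require Import all_classical all_reals all_analysis.
From mathcomp Require complex.

Set Implicit Arguments.
Unset Strict Implicit.
Unset Printing Implicit Defensive.

Import Order.TTheory GRing.Theory Num.Theory.
Import numFieldNormedType.Exports.

Local Open Scope classical_set_scope.
Local Open Scope ring_scope.

(* The scalar field of a Banach space, real or complex: a numFieldType whose
   real elements form a copy of R. Both cases are instances, see real_scalars
   and complex_scalars. Since norms of a normedModType K take values in K,
   [ofR] is also what turns them into real numbers (see nrm). *)
Record scalars (R : realType) := Scalars {
  scalar_field :> numFieldType;
  ofR : {rmorphism R -> scalar_field};
  ofR_le : forall a b : R, (ofR a <= ofR b) = (a <= b);
  ofR_real : forall z : scalar_field, z \is Num.real -> exists a, z = ofR a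
}.

Lemma real_scalars_le (R : realType) (a b : R) :
  ((idfun : {rmorphism R -> R}) a <= (idfun : {rmorphism R -> R}) b)
    = (a <= b).
Proof. by []. Qed.

Lemma real_scalars_real (R : realType) (z : R) :
  z \is Num.real -> exists a, z = (idfun : {rmorphism R -> R}) a.
Proof. by move=> _; exists z. Qed.

Definition real_scalars (R : realType) : scalars R :=
  @Scalars R R idfun (@real_scalars_le R) (@real_scalars_real R).

Section complex_scalars.
Import -(notations) complex.
Variable R : realType.

Lemma complex_scalars_le (a b : R) :
  (real_complex R a <= real_complex R b) = (a <= b).
Proof. exact: lecR. Qed.

Lemma complex_scalars_real (z : complex R) :
  z \is Num.real -> exists a, z = real_complex R a.
Proof. by move=> /complex_realP. Qed.

Definition complex_scalars : scalars R :=
  @Scalars R (complex R) (real_complex R)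
    complex_scalars_le complex_scalars_real.

End complex_scalars.

(* Unbounded operators are given by their graphs; [graph_inv A y] is the x
   with A x = y when A is injective and y belongs to its range. *)
Definition graph_inv (U : nmodType) (V : Type) (A : U -> V -> Prop) (y : V) : U :=
  xget 0 [set x | A x y].

Definition graph_dom (U V : Type) (A : U -> V -> Prop) : set U :=
  [set x | exists y, A x y].

Section norms.
Variables (R : realType) (K : scalars R).

Definition nrm (V : normedModType K) (x : V) : R :=
  xget 0 [set a : R | ofR K a = `|x|].

Definition opnorm (U V : normedModType K) (f : U -> V) : \bar R :=
  ereal_sup [set (nrm (f x))%:E | x in [set x : U | nrm x <= 1]].

Definition bounded_linear (U V : normedModType K) (f : U -> V) : Prop :=
  linear f /\ (opnorm f < +oo)%E.

Definition resolvent_set (X : normedModType K) (A : X -> X -> Prop) : set K :=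
  [set l | exists S : X -> X, bounded_linear S /\
     forall x y, (exists2 z, A x z & y = l *: x - z) <-> x = S y].

End norms.

Section locally_convex.
Variables (R : realType) (K : scalars R).

Definition seminorm (V : lmodType K) (p : V -> R) : Prop :=
  (forall x y, p (x + y) <= p x + p y) /\
  (forall (k : K) x, p (k *: x) = nrm (k : K^o) * p x).

(* Neighbourhood filter of x for the topology generated by the family P:
   finite intersections of P-balls form a basis (P need not be directed). *)
Definition tau_nbhs (V : lmodType K) (P : set (V -> R)) (x : V) : set_system V :=
  [set U | exists (n : nat) (q : 'I_n -> V -> R) (e : R),
     [/\ 0 < e, (forall i, P (q i)) &
         forall y, (forall i, q i (y - x) < e) -> U y]].

Definition tau_continuous_on (V : lmodType K) (P : set (V -> R)) (D : set R)
    (f : R -> V) : Prop :=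
  forall t, D t -> f @ within D (nbhs t) `=>` tau_nbhs P (f t).

Definition tau_cauchy_seq (V : lmodType K) (P : set (V -> R)) (u : nat -> V) :=
  forall p, P p -> forall e : R, 0 < e ->
    exists N : nat, forall m n, (N <= m)%N -> (N <= n)%N -> p (u m - u n) < e.

(* [is_tau_integral P f a b I]: the Riemann sums of f over tagged partitions
   of [a, b] (a <= b) converge to I in the topology generated by P, as the mesh
   tends to 0. *)
Definition is_tau_integral (V : lmodType K) (P : set (V -> R)) (f : R -> V)
    (a b : R) (I : V) : Prop :=
  forall U, tau_nbhs P I U -> exists2 d : R, 0 < d &
    forall (n : nat) (s xi : nat -> R), s 0%N = a -> s n = b ->
      (forall i, (i < n)%N ->
         [/\ s i <= xi i, xi i <= s i.+1 & s i.+1 - s i < d]) ->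
      U (\sum_(i < n) ofR K (s i.+1 - s i) *: f (xi i)).

End locally_convex.

Section bicontinuous.
Variables (R : realType) (K : scalars R).

(* The triple (X, |.|, tau), with tau the topology generated by P. *)
Record bicont_space (X : completeNormedModType K) (P : set (X -> R)) : Prop := {
  bs_seminorm : forall p, P p -> seminorm p;
  bs_hausdorff : forall x y, (forall U V, tau_nbhs P x U -> tau_nbhs P y V ->
    U `&` V !=set0) -> x = y;
  bs_coarser : forall x, tau_nbhs P x `<=` nbhs x;
  bs_complete : forall u : nat -> X,
    (exists C : R, forall n, nrm (u n) <= C) -> tau_cauchy_seq P u ->
    exists l, u @ \oo `=>` tau_nbhs P l;
  bs_norming : forall x, (nrm x)%:E =
    ereal_sup [set (nrm (phi x))%:E | phi in [set phi : X -> K^o |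
      [/\ linear phi,
          (forall y, phi @ tau_nbhs P y `=>` nbhs (phi y)) &
          (opnorm phi <= 1)%E]]];
  bs_norm_sup : forall x, (nrm x)%:E = ereal_sup [set (p x)%:E | p in P]
}.

Section over_X.
Variables (X : normedModType K) (P : set (X -> R)).

Definition bi_equicontinuous (Bs : set (X -> X)) : Prop :=
  forall u : nat -> X,
    (exists C : R, forall n, nrm (u n) <= C) -> u @ \oo `=>` tau_nbhs P 0 ->
    forall U, tau_nbhs P 0 U ->
      \forall n \near \oo, forall B, Bs B -> U (B (u n)).

(* Only the values of T on [0, +oo[ matter. *)
Record bicont_semigroup (T : R -> X -> X) : Prop := {
  sg_bounded : forall t, 0 <= t -> bounded_linear (T t);
  sg_add : forall t s x, 0 <= t -> 0 <= s -> T (t + s) x = T t (T s x);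
  sg_zero : forall x, T 0 x = x;
  sg_cont : forall x, tau_continuous_on P `[0, +oo[ (fun t => T t x);
  sg_growth : exists M w : R, 1 <= M /\
    forall t, 0 <= t -> (opnorm (T t) <= (M * expR (w * t))%:E)%E;
  sg_equi : forall s, 0 < s -> bi_equicontinuous [set T t | t in `[0, s]]
}.

Definition generator (T : R -> X -> X) (x y : X) : Prop :=
  (fun t => ofR K t^-1 *: (T t x - x)) @ 0^'+ `=>` tau_nbhs P y /\
  exists C : R, forall t, 0 < t <= 1 -> nrm (T t x - x) / t <= C.

Definition generates_bicont_semigroup (A : X -> X -> Prop) : Prop :=
  exists2 S, bicont_semigroup S & forall x y, generator S x y <-> A x y.

Definition Cb (t0 : R) : set (R -> X) :=
  [set f | tau_continuous_on P `[0, t0] f /\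
           exists C : R, forall r, r \in `[0, t0] -> nrm (f r) <= C].

(* Supremum over [0, t0] of g : R -> R. *)
Definition sup_on (t0 : R) (g : R -> R) : \bar R :=
  ereal_sup [set (g r)%:E | r in `[0, t0]].

Definition op_supnorm (t0 : R) (F : R -> X -> X) : \bar R :=
  ereal_sup [set opnorm (F t) | t in `[0, t0]].

(* The Banach space of operator-valued functions on [0, t0]; its elements are
   represented by functions on R whose values off [0, t0] are ignored. *)
Definition frakX (t0 : R) : set (R -> X -> X) :=
  [set F | [/\ (forall t, t \in `[0, t0] -> bounded_linear (F t)),
               (forall x, tau_continuous_on P `[0, t0] (fun t => F t x)),
               (op_supnorm t0 F < +oo)%E &
               bi_equicontinuous [set F t | t in `[0, t0]]]].

End over_X.

(* (E', j) is a completion of E for the norm |C^-1 x|, and C' : E -> E' is the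
   isometric extension of C, with E regarded as a subspace of E' through j. *)
Record extrapolation_step (E E' : completeNormedModType K) (C : E -> E -> Prop)
    (j C' : {linear E -> E'}) : Prop := {
  es_norm : forall x, nrm (j x) = nrm (graph_inv C x);
  es_dense : dense (range j);
  es_isometry : forall x, nrm (C' x) = nrm x;
  es_extends : forall x y, C x y -> C' x = j y
}.

(* The extrapolation spaces of an operator A on X with 0 in its resolvent set.
   Completions being determined up to isometric isomorphism only, the spaces
   are arbitrary ones with the defining properties:
   - eX0, embedded in X by ei0, is the norm closure of D(A);
   - eU1, eU2 are the underlined spaces of index -1 and -2, in which eX0, resp.
     eU1, is embedded by ej0, resp. ej1; eA1 : eX0 -> eU1 and eA2 : eU1 -> eU2
     are the underlined operators of index -1 and -2;
   - eX1, embedded in eU2 by ei1, is X_{-1} = eA2(X), X being a subspace of eU1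
     through eA1 A^-1; and eA : X -> X_{-1} is the restriction of eA2 to X. *)
Record extrapolation (X : completeNormedModType K) (A : X -> X -> Prop) :=
  Extrapolation {
  eX0 : completeNormedModType K;
  ei0 : {linear eX0 -> X};
  ei0_isometry : forall x, nrm (ei0 x) = nrm x;
  ei0_range : range ei0 = closure (graph_dom A);
  eA0 : eX0 -> eX0 -> Prop := fun x y => A (ei0 x) (ei0 y);
  eU1 : completeNormedModType K;
  ej0 : {linear eX0 -> eU1};
  eA1 : {linear eX0 -> eU1};
  e_step1 : extrapolation_step eA0 ej0 eA1;
  eU2 : completeNormedModType K;
  ej1 : {linear eU1 -> eU2};
  eA2 : {linear eU1 -> eU2};
  e_step2 : extrapolation_step
    (fun u v => exists2 x, u = ej0 x & v = eA1 x) ej1 eA2;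
  eXU : X -> eU1 := fun x => eA1 (graph_inv (fun z y => A (ei0 z) y) x);
  eX1 : normedModType K;
  ei1 : {linear eX1 -> eU2};
  ei1_inj : injective ei1;
  ei1_range : range ei1 = range (eA2 \o eXU);
  eA : {linear X -> eX1};
  eA_restr : forall x, ei1 (eA x) = eA2 (eXU x);
  eA_norm : forall x, nrm (eA x) = nrm x
}.

Section extrapolated.
Variables (X : completeNormedModType K) (P : set (X -> R)).
Variables (A : X -> X -> Prop) (E : extrapolation A).

Definition eA_inv : eX1 E -> X := graph_inv (fun x y => eA E x = y).

(* The inclusion of X in X_{-1}. *)
Definition emb (x : X) : eX1 E := eA E (graph_inv A x).

Definition P1 : set (eX1 E -> R) := [set (p \o eA_inv) | p in P].

Definition T1 (T : R -> X -> X) (t : R) (y : eX1 E) : eX1 E :=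
  eA E (T t (eA_inv y)).

(* The integral of r |-> T_{-1}(t - r) B f(r) over [0, t] exists and equals
   the element y of X. *)
Definition conv_integral (T : R -> X -> X) (B : X -> eX1 E) (f : R -> X)
    (t : R) (y : X) : Prop :=
  is_tau_integral P1 (fun r => T1 T (t - r) (B (f r))) 0 t (emb y).

Definition bounded_tau_continuous (B : X -> eX1 E) : Prop :=
  bounded_linear B /\ forall x, B @ tau_nbhs P x `=>` tau_nbhs P1 (B x).

(* The graph of V_B, restricted to those F for which V_B F takes values in X. *)
Definition V_graph (T : R -> X -> X) (B : X -> eX1 E) (t0 : R)
    (F G : R -> X -> X) : Prop :=
  forall t x, t \in `[0, t0] -> conv_integral T B (fun r => F r x) t (G t x).

Definition DS_admissible (T : R -> X -> X) (t0 : R) : set (X -> eX1 E) :=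
  [set B | [/\ bounded_tau_continuous B,
    (forall F t x, frakX P t0 F -> t \in `[0, t0] ->
       exists y, conv_integral T B (fun r => F r x) t y),
    (forall F G, frakX P t0 F -> V_graph T B t0 F G -> frakX P t0 G) &
    (ereal_sup [set v | exists F G, [/\ frakX P t0 F, (op_supnorm t0 F <= 1)%E,
       V_graph T B t0 F G & v = op_supnorm t0 G]] < 1)%E]].

(* The part of A_{-1} + B in X. *)
Definition perturbed (B : X -> eX1 E) (x y : X) : Prop :=
  eA E x + B x = emb y.

End extrapolated.
End bicontinuous.

(* Main.v *)
From HB Require Import structures.
Require Import Defs.
From mathcomp Require Import all_boot all_order all_algebra.
From mathcomp Require Import all_classical all_reals all_analysis.
From mathcomp Require Import ring lra.
Set Implicit Arguments.
Unset Strict Implicit.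
Unset Printing Implicit Defensive.
Import Order.TTheory GRing.Theory Num.Theory.
Import numFieldNormedType.Exports.
Local Open Scope classical_set_scope.
Local Open Scope ring_scope.

(** The isomorphism [eA] between X and the extrapolation space turns the problem
    into one on X alone. Let J be the inverse of the generator A and C the operator
    B followed by the inverse of [eA]. Then the convolution of T_{-1} with B f equals
    y in X if and only if the convolution of T with C f equals J y, so that V_B f is A
    applied to the convolution of T with C f, and the part of A_{-1} + B in X is
    A (1 + C): it relates x to y when x + C x = J y ([tau_integral_eA]).

    The hypotheses concern V_B at the final time t0 only. For t < t0, precede f, read
    on [t0 - t, t0], by a ramp of length d from 0 to f 0, and by 0 before. The ramp
    contributes A applied to an integral that is computed by parts: the result is
    (T d (J z) - J z) / d - z with z = T t (C (f 0)), which tends to 0 with d because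
    J z lies in the domain of A ([conv_ramp_extension]). Hence V_B f at time t obeys
    the bounds assumed at t0 with the same constants ([ctrl_sn], [ctrl_nrm]). Applied
    to f minus a translate of f, they give continuity in time ([ucb_ctrl]); applied to
    orbits of null sequences, bi-equicontinuity ([cc_frakX]). As M < 1 this is
    admissibility.

    For generation, u = T x + V_B u is solved by Picard iteration in the bounded
    continuous functions on [0, t0] ([fixpoint_exists], [pert]). Uniqueness makes the
    solution operators S a semigroup as long as times add up to at most t0
    ([pert_add]), and dividing the time into steps extends it to all times
    ([bicont_semigroup_ext]). Bi-equicontinuity of S does not follow from a
    contraction for the seminorms, which V_B need not be: finitely many terms of the
    Neumann series are controlled by seminorms, and the rest is small in norm
    ([pert_split]). The generator is found by first order expansions at 0
    ([generator_pert]): S r x - x equals T r (x + C x) - (x + C x) plus V_B applied to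
    S x - x, and V_B is negligible on r y and on negligible functions; so S r x has
    expansion x + r y exactly when x + C x is in the domain of A and is mapped to y.

    Integrals are handled through functions that are differentiable uniformly for
    each seminorm ([prim]); a bounded continuous function has such a primitive
    ([prim_exists]), and its increments are the Riemann integrals. *)

(** * Identities between linear combinations *)

Section linear_combinations.
Variables (F : comNzRingType) (V : lmodType F).

Inductive lincomb : Type :=
  | LC0 | LCatom of nat | LCadd of lincomb & lincomb | LCopp of lincomb
  | LCscale of F & lincomb.

Fixpoint lc_eval (env : seq V) e : V := match e with
  | LC0 => 0
  | LCatom j => env`_j
  | LCadd a b => lc_eval env a + lc_eval env b
  | LCopp a => - lc_eval env a
  | LCscale k a => k *: lc_eval env a
  end.

Fixpoint lc_coef e (i : nat) : F := match e with
  | LC0 => 0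
  | LCatom j => if eqn i j then 1 else 0
  | LCadd a b => lc_coef a i + lc_coef b i
  | LCopp a => - lc_coef a i
  | LCscale k a => k * lc_coef a i
  end.

Fixpoint lc_same_coefs e1 e2 (n : nat) : Prop :=
  if n is m.+1 then lc_coef e1 m = lc_coef e2 m /\ lc_same_coefs e1 e2 m
  else True.

Lemma lc_evalE (env : seq V) e :
  lc_eval env e = \sum_(i < size env) lc_coef e i *: env`_i.
Proof.
elim: e => [|j|a IHa b IHb|a IHa|k a IHa] /=.
- by rewrite big1// => i _; rewrite scale0r.
- have [js|js] := ltnP j (size env).
    rewrite (bigD1 (Ordinal js))//= (introT eqnP (erefl j)) scale1r.
    rewrite big1 ?addr0// => i ij.
    case: eqnP => [ij'|_]; last by rewrite scale0r.
    by move/negP : ij; case; apply/eqP/val_inj.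
  rewrite nth_default// big1// => i _.
  case: eqnP => [ij|_]; last by rewrite scale0r.
  by move: (ltn_ord i); rewrite ij ltnNge js.
- by rewrite IHa IHb -big_split; apply: eq_bigr => i _; rewrite scalerDl.
- by rewrite IHa -sumrN; apply: eq_bigr => i _; rewrite scaleNr.
- by rewrite IHa scaler_sumr; apply: eq_bigr => i _; rewrite scalerA.
Qed.

Lemma lc_eval_eq (env : seq V) e1 e2 : lc_same_coefs e1 e2 (size env) ->
  lc_eval env e1 = lc_eval env e2.
Proof.
move=> h; rewrite !lc_evalE; apply: eq_bigr => i _; congr (_ *: _).
move: (nat_of_ord i) (ltn_ord i); elim: (size env) h => // n IH /= [hn /IH h] j.
by rewrite ltnS leq_eqVlt => /predU1P[-> //|]; exact: h.
Qed.

End linear_combinations.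

(* Atoms are compared up to conversion: the same vector may occur with
   different but convertible structures on the type of real numbers. *)
Ltac lc_index x l := lazymatch l with
  | ?y :: ?t => match goal with
      | _ => let _ := match goal with _ => unify x y end in constr:(0%N)
      | _ => let n := lc_index x t in constr:(S n)
      end
  end.

Ltac lc_insert x l := match goal with
  | _ => let _ := lc_index x l in l
  | _ => constr:(x :: l)
  end.

Ltac lc_atoms V t l := lazymatch t with
  | (0 : _) => l
  | (?a + ?b)%R => let l := lc_atoms V a l in lc_atoms V b l
  | (- ?a)%R => lc_atoms V a l
  | (_ *: ?a)%R => lc_atoms V a l
  | _ => lc_insert (t : V) l
  end.

Ltac lc_reify F V t l := lazymatch t with
  | (0 : _) => constr:(@LC0 F)
  | (?a + ?b)%R =>
      let a' := lc_reify F V a l in let b' := lc_reify F V b l in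
      constr:(@LCadd F a' b')
  | (- ?a)%R => let a' := lc_reify F V a l in constr:(@LCopp F a')
  | (?k *: ?a)%R => let a' := lc_reify F V a l in constr:(@LCscale F k a')
  | _ => let i := lc_index (t : V) l in constr:(@LCatom F i)
  end.

(** Proves an identity between linear combinations over [F] of vectors of the
    left module [V] by comparing the coefficients of every atom. *)
Ltac lincomb_over F V := lazymatch goal with
  | |- ?s = ?t =>
      let l := lc_atoms V s (@nil V) in
      let l := lc_atoms V t l in
      let s' := lc_reify F V s l in
      let t' := lc_reify F V t l in
      change (@lc_eval F V l s' = @lc_eval F V l t');
      apply: lc_eval_eq;
      cbn [size lc_same_coefs lc_coef eqn]; repeat split; ring
  end.

Ltac lincomb := lazymatch goal with
  X : completeNormedModType ?F |- _ => lincomb_over F X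
  end.

(** * Real-valued norms and bounded operators *)

Section real_scalars_in_K.
Variables (R : realType) (K : scalars R).

Lemma ofR_norm (a : R) : `|ofR K a| = ofR K `|a|.
Proof.
have ofR_ge0 (b : R) : (0 <= ofR K b) = (0 <= b).
  by rewrite -(rmorph0 (ofR K)) ofR_le.
have [a0|a0] := leP 0 a; first by rewrite !ger0_norm ?ofR_ge0.
by rewrite -normrN -rmorphN ger0_norm ?ofR_ge0 ?oppr_ge0 1?ltW// ltr0_norm.
Qed.

Lemma ofR_inj : injective (ofR K).
Proof. exact: fmorph_inj. Qed.

Variable V : normedModType K.
Implicit Types x y : V.

Lemma ofR_nrm x : ofR K (nrm x) = `|x|.
Proof.
have [a xa] := ofR_real (normr_real x).
by rewrite /nrm; case: xgetP => [b -> //|/(_ a)]; rewrite /= -xa.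
Qed.

Lemma nrm_ge0 x : 0 <= nrm x.
Proof. by rewrite -(ofR_le K) rmorph0 ofR_nrm. Qed.

Lemma nrm0 : nrm (0 : V) = 0.
Proof. by apply: ofR_inj; rewrite ofR_nrm normr0 rmorph0. Qed.

Lemma nrm0_eq0 x : nrm x = 0 -> x = 0.
Proof. by move=> x0; apply: normr0_eq0; rewrite -ofR_nrm x0 rmorph0. Qed.

Lemma nrmD x y : nrm (x + y) <= nrm x + nrm y.
Proof. by rewrite -(ofR_le K) rmorphD !ofR_nrm ler_normD. Qed.

Lemma nrmN x : nrm (- x) = nrm x.
Proof. by apply: ofR_inj; rewrite !ofR_nrm normrN. Qed.

Lemma nrmB x y : nrm (x - y) <= nrm x + nrm y.
Proof. by rewrite -(nrmN y) nrmD. Qed.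

Lemma nrmZ (a : R) x : nrm (ofR K a *: x) = `|a| * nrm x.
Proof. by apply: ofR_inj; rewrite rmorphM !ofR_nrm normrZ ofR_norm. Qed.

Lemma nrm_sum (I : Type) (r : seq I) (F : I -> V) :
  nrm (\sum_(i <- r) F i) <= \sum_(i <- r) nrm (F i).
Proof.
elim/big_ind2 : _ => [|x1 x2 y1 y2 h1 h2|//]; first by rewrite nrm0.
exact: le_trans (nrmD _ _) (lerD h1 h2).
Qed.

End real_scalars_in_K.

Lemma nrmZK (R : realType) (K : scalars R) (V : normedModType K) (a : K) (x : V) :
  nrm (a *: x) = nrm (a : K^o) * nrm x.
Proof. by apply: (@ofR_inj _ K); rewrite rmorphM !ofR_nrm normrZ. Qed.

Lemma nrm_ofR (R : realType) (K : scalars R) (a : R) :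
  nrm (ofR K a : K^o) = `|a|.
Proof. by apply: (@ofR_inj _ K); rewrite ofR_nrm ofR_norm. Qed.

Section bounded_operators.
Variables (R : realType) (K : scalars R) (U V : normedModType K) (f : U -> V).
Hypothesis lf : linear f.

Lemma lin_pack : exists g : {linear U -> V}, g = f :> (U -> V).
Proof.
pose m := GRing.isLinear.Build K U V *:%R f lf.
by exists (HB.pack_for {linear U -> V} f m).
Qed.

Lemma lin0 : f 0 = 0.
Proof. by have [g <-] := lin_pack; rewrite linear0. Qed.

Lemma linD x y : f (x + y) = f x + f y.
Proof. by have [g <-] := lin_pack; rewrite linearD. Qed.

Lemma linB x y : f (x - y) = f x - f y.
Proof. by have [g <-] := lin_pack; rewrite linearB. Qed.

Lemma linZ a x : f (a *: x) = a *: f x.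
Proof. by have [g <-] := lin_pack; rewrite linearZ. Qed.

Lemma lin_sum I (r : seq I) (F : I -> U) :
  f (\sum_(i <- r) F i) = \sum_(i <- r) f (F i).
Proof. by have [g <-] := lin_pack; rewrite linear_sum. Qed.

Lemma opnorm_leP (c : R) : 0 <= c ->
  (opnorm f <= c%:E)%E <-> forall x, nrm (f x) <= c * nrm x.
Proof.
move=> c0; split=> [fc x|fc].
  have [x0|x0] := eqVneq (nrm x) 0.
    by rewrite (nrm0_eq0 x0) lin0 !nrm0 mulr0.
  have xp : 0 < nrm x by rewrite lt_def x0 nrm_ge0.
  have h : (nrm (f (ofR K (nrm x)^-1 *: x)) <= c).
    rewrite -lee_fin; apply: le_trans fc; apply: ereal_sup_ubound.
    exists (ofR K (nrm x)^-1 *: x) => //=.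
    by rewrite nrmZ gtr0_norm ?invr_gt0// mulVf.
  by move: h; rewrite linZ nrmZ gtr0_norm ?invr_gt0// mulrC ler_pdivrMr.
apply: ge_ereal_sup => _ [x /= x1 <-]; rewrite lee_fin.
by apply: le_trans (fc x) _; rewrite -[leRHS]mulr1 ler_wpM2l.
Qed.

Lemma opnorm_ge0 : (0 <= opnorm f)%E.
Proof.
apply: ereal_sup_ubound; exists 0 => /=; first by rewrite nrm0.
by rewrite lin0 nrm0.
Qed.

End bounded_operators.

Lemma bounded_linearP (R : realType) (K : scalars R) (U V : normedModType K)
    (f : U -> V) : bounded_linear f <->
  linear f /\ exists2 c : R, 0 <= c & forall x, nrm (f x) <= c * nrm x.
Proof.
split=> [[lf fb]|[lf [c c0 fc]]].
  split=> //; exists (fine (opnorm f)); first by rewrite fine_ge0// opnorm_ge0.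
  apply/(opnorm_leP lf); first by rewrite fine_ge0// opnorm_ge0.
  by rewrite fineK// ge0_fin_numE// opnorm_ge0.
split=> //; move/(opnorm_leP lf c0) : fc => /le_lt_trans; apply.
exact: ltry.
Qed.

(** * Seminorms, convergence and bi-equicontinuity *)

Section topology.
Variables (R : realType) (K : scalars R) (X : completeNormedModType K).
Variables (P : set (X -> R)) (hX : bicont_space P).
Implicit Types (p : X -> R) (x y : X) (f g G : R -> X) (u : nat -> X).

Lemma snD p x y : P p -> p (x + y) <= p x + p y.
Proof. by move=> /(bs_seminorm hX)[]. Qed.

Lemma snZK p (a : K) x : P p -> p (a *: x) = nrm (a : K^o) * p x.
Proof. by move=> /(bs_seminorm hX)[_ ->]. Qed.

Lemma snZ p (a : R) x : P p -> p (ofR K a *: x) = `|a| * p x.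
Proof. by move=> Pp; rewrite snZK// nrm_ofR. Qed.

Lemma sn0 p : P p -> p 0 = 0.
Proof. by move=> Pp; rewrite -[0 in LHS](scale0r 0) -(rmorph0 (ofR K)) snZ// normr0 mul0r. Qed.

Lemma snN p x : P p -> p (- x) = p x.
Proof.
move=> Pp; rewrite -scaleN1r -(rmorph1 (ofR K)) -rmorphN snZ//.
by rewrite normrN1 mul1r.
Qed.

Lemma snB p x y : P p -> p (x - y) <= p x + p y.
Proof. by move=> Pp; rewrite -(snN y Pp); exact: snD. Qed.

Lemma snC p x y : P p -> p (x - y) = p (y - x).
Proof. by move=> Pp; rewrite -snN// opprB. Qed.

Lemma sn_ge0 p x : P p -> 0 <= p x.
Proof.
move=> Pp; have := snD x (- x) Pp; rewrite subrr sn0// snN//; lra.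
Qed.

Lemma sn_triangle p z x y : P p -> p (x - y) <= p (x - z) + p (z - y).
Proof. by move=> Pp; rewrite -(subrKA z x (- y)); exact: snD. Qed.

Lemma sn_sum p (I : Type) (r : seq I) (F : I -> X) : P p ->
  p (\sum_(i <- r) F i) <= \sum_(i <- r) p (F i).
Proof.
move=> Pp; elim/big_ind2 : _ => [|x1 x2 y1 y2 h1 h2|//]; first by rewrite sn0.
exact: le_trans (snD _ _ Pp) (lerD h1 h2).
Qed.

Lemma sn_le_nrm p x : P p -> p x <= nrm x.
Proof.
move=> Pp; rewrite -lee_fin (bs_norm_sup hX); apply: ereal_sup_ubound.
by exists p.
Qed.

Lemma nrm_le_sn x (c : R) : (forall p, P p -> p x <= c) -> nrm x <= c.
Proof.
move=> h; rewrite -lee_fin (bs_norm_sup hX); apply: ge_ereal_sup => _ [p Pp <-].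
by rewrite lee_fin; exact: h.
Qed.

(** The seminorms separate points because their supremum is the norm. *)
Lemma sn_lt_eq x y :
  (forall p (e : R), P p -> 0 < e -> p (x - y) <= e) -> x = y.
Proof.
move=> h; apply/eqP; rewrite -subr_eq0; apply/eqP/nrm0_eq0.
apply/eqP; rewrite eq_le nrm_ge0 andbT; apply: nrm_le_sn => p Pp.
by apply/ler_addgt0Pr => e e0; rewrite add0r; exact: h.
Qed.

Lemma nrm_le_eps x (c : R) :
  (forall p (e : R), P p -> 0 < e -> p x <= c + e) -> nrm x <= c.
Proof. by move=> h; apply: nrm_le_sn => p Pp; apply/ler_addgt0Pr => e; exact: h. Qed.

Lemma tau_cvgP (I : Type) (F : set_system I) {FF : Filter F} (f : I -> X) x :
  f @ F `=>` tau_nbhs P x <->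
  forall p (e : R), P p -> 0 < e -> \forall i \near F, p (f i - x) < e.
Proof.
split=> [h p e Pp e0|h U [n [q [e [e0 Pq qU]]]]].
  apply: (h [set y | p (y - x) < e]); exists 1%N, (fun=> p), e; split=> // y.
  by move/(_ ord0).
have : \forall i \near F, forall k : 'I_n, q k (f i - x) < e.
  by apply: filter_forall => k; exact: h.
by apply: filterS => i /qU.
Qed.

Definition tau_seq_lim u x := forall p (e : R), P p -> 0 < e ->
  exists N, forall n, (N <= n)%N -> p (u n - x) < e.

Lemma tau_seq_limP u x : u @ \oo `=>` tau_nbhs P x <-> tau_seq_lim u x.
Proof.
rewrite tau_cvgP; split=> h p e Pp e0.
  by have [N _ hN] := h p e Pp e0; exists N => n Nn; exact: hN.
by have [N hN] := h p e Pp e0; exists N => // n Nn; exact: hN.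
Qed.

Definition seq_bounded u := exists C : R, forall n, nrm (u n) <= C.

Lemma bi_equicontinuousP (Bs : set (X -> X)) : bi_equicontinuous P Bs <->
  forall u, seq_bounded u -> tau_seq_lim u 0 -> forall p (e : R), P p -> 0 < e ->
    exists N, forall n, (N <= n)%N -> forall B, Bs B -> p (B (u n)) < e.
Proof.
split=> [h u ub u0 p e Pp e0|h u ub /tau_seq_limP u0 U [n [q [e [e0 Pq qU]]]]].
  have := h u ub; rewrite tau_seq_limP => /(_ u0 [set x | p x < e]) []//.
    exists 1%N, (fun=> p), e; split=> // y /(_ ord0).
    by rewrite subr0.
  by move=> N _ hN; exists N => n Nn B; exact: hN.
have : \forall i \near \oo, forall k : 'I_n, forall B, Bs B -> q k (B (u i)) < e.
  apply: filter_forall => k; have [N hN] := h u ub u0 (q k) e (Pq k) e0.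
  by exists N => // m Nm; exact: hN.
apply: filterS => i hi B BsB; apply: qU => k; rewrite subr0; exact: hi.
Qed.

(** Sequences suffice to exploit bi-equicontinuity along any family of vectors
    whose smallness is measured by a real parameter [m]. *)
Lemma bi_equi_uniform (Bs : set (X -> X)) (I : Type) (D : I -> Prop)
    (m : I -> R) (v : I -> X) (C : R) :
  bi_equicontinuous P Bs ->
  (forall i, D i -> nrm (v i) <= C) ->
  (forall p (e : R), P p -> 0 < e ->
    exists2 d : R, 0 < d & forall i, D i -> m i < d -> p (v i) < e) ->
  forall p (e : R), P p -> 0 < e ->
    exists2 d : R, 0 < d & forall i, D i -> m i < d ->
      forall B, Bs B -> p (B (v i)) < e.
Proof.
move=> /bi_equicontinuousP hB vC v0 p e Pp e0; apply: contrapT => nd.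
have bad n : exists i, [/\ D i, m i < n.+1%:R^-1 &
    exists2 B, Bs B & e <= p (B (v i))].
  apply: contrapT => ni; apply: nd; exists n.+1%:R^-1 => // i Di mi B BsB.
  rewrite ltNge; apply/negP => hle; apply: ni; exists i; split=> //.
  by exists B.
have [s hs] := choice bad.
have [||N hN] := hB (v \o s) _ _ p e Pp e0.
- by exists C => n; apply: vC; have [] := hs n.
- move=> q e' Pq e'0; have [d d0 hd] := v0 q e' Pq e'0.
  have [N hN] : exists N, N.+1%:R^-1 < d.
    exists (Num.truncn d^-1).+1; rewrite invf_plt ?posrE//.
    apply: lt_trans (truncnS_gt _) _; rewrite ltr_nat//.
  exists N => n Nn; rewrite subr0 /=; have [Ds ms _] := hs n.
  apply: hd => //; apply: lt_le_trans ms _; apply: le_trans (ltW hN).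
  by rewrite lef_pV2 ?posrE// ler_nat.
- have [_ _ [B BsB]] := hs N.
  by rewrite leNgt hN.
Qed.

(** * Continuous functions on a compact interval *)

Definition ucont (b : R) f := forall p (e : R), P p -> 0 < e ->
  exists2 d : R, 0 < d & forall s t : R, 0 <= s <= b -> 0 <= t <= b -> `|s - t| < d ->
    p (f s - f t) < e.

Definition bdd_by (b : R) f (c : R) := forall t : R, 0 <= t <= b -> nrm (f t) <= c.

(** Members of C_b([0, b], (X, tau)), uniform continuity being automatic. *)
Definition ucb (b : R) f := ucont b f /\ exists c, bdd_by b f c.

Definition pcont (b : R) f := forall t : R, 0 <= t <= b -> forall p (e : R), P p -> 0 < e ->
  exists2 d : R, 0 < d & forall s : R, 0 <= s <= b -> `|s - t| < d -> p (f s - f t) < e.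

Lemma pcontP (b : R) f : tau_continuous_on P `[0, b] f <-> pcont b f.
Proof.
split=> [h t tb p e Pp e0|h t].
  have /h : `[0, b]%classic t by rewrite /= in_itv.
  move=> /tau_cvgP /(_ p e Pp e0).
  rewrite near_withinE => /nbhs_ballP [d /= d0 hd]; exists d => // s sb st.
  by apply: hd; rewrite /= ?in_itv// /ball/= distrC.
rewrite /= in_itv/= => tb; apply/tau_cvgP => p e Pp e0.
have [d d0 hd] := h t tb p e Pp e0.
rewrite near_withinE; apply/nbhs_ballP; exists d => //= s st.
by rewrite /= in_itv/= => sb; apply: hd => //; rewrite distrC.
Qed.

(** Heine's theorem, one seminorm at a time, by compactness of the interval. *)
Lemma heine (b : R) f : pcont b f -> ucont b f.
Proof.
move=> h p e Pp e0.
have /compact_near_coveringP cov := @segment_compact R 0 b.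
have : \forall d \near (0 : R)^'+, `[0, b]%classic `<=` [set y : R |
    0 <= y <= b -> forall z : R, 0 <= z <= b -> `|z - y| < d -> p (f z - f y) < e].
  apply: (cov R (0 : R)^'+ (fun d => [set y : R |
    0 <= y <= b -> forall z : R, 0 <= z <= b -> `|z - y| < d -> p (f z - f y) < e])).
  move=> x; rewrite /= in_itv/= => xb.
  have [d d0 hd] := h x xb p (e / 2) Pp ltac:(lra).
  exists ([set y | `|y - x| < d / 2], [set r | r < d / 2]) => /=.
    split.
      apply/nbhs_ballP; exists (d / 2) => /=; first lra.
      by move=> y; rewrite /ball/= distrC.
    by apply: nbhs_right_lt; lra.
  move=> [y r] [/= yx rd] yb z zb zy.
  have zx : `|z - x| < d.
    have := ler_distD y z x; lra.
  have h1 := hd z zb zx; have h2 := hd y yb ltac:(lra).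
  have := sn_triangle (f x) (f z) (f y) Pp; rewrite (snC (f x))//; lra.
rewrite near_withinE => /nbhs_ballP[d /= d0 hd].
exists (d / 2); first lra.
have dd : `|0 - d / 2| < d by rewrite sub0r normrN gtr0_norm; lra.
move=> s t sb tb st; apply: (hd (d / 2) dd) => //=; lra.
Qed.

Lemma ucont_p (b : R) f : ucont b f -> pcont b f.
Proof.
move=> h t tb p e Pp e0; have [d d0 hd] := h p e Pp e0; exists d => // s sb.
exact: hd.
Qed.

Lemma CbP (b : R) f : Cb P b f <-> ucb b f.
Proof.
split=> [[/pcontP/heine fc [c fb]]|[/ucont_p/pcontP fc [c fb]]]; split=> //;
  exists c => t; last by rewrite in_itv; exact: fb.
by move=> tb; apply: fb; rewrite in_itv.
Qed.

Lemma ucbZD (b : R) (a : K) f g : ucb b f -> ucb b g ->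
  ucb b (fun r => a *: f r + g r).
Proof.
set na := nrm (a : K^o); have na0 : 0 <= na by exact: nrm_ge0.
move=> [fc [c fb]] [gc [c' gb]]; split; last first.
  exists (na * c + c') => t tb; apply: le_trans (nrmD _ _) _.
  by rewrite nrmZK -/na lerD ?gb// ler_wpM2l// fb.
move=> p e Pp e0; have a0 : 0 < na + 1 by rewrite ltr_wpDl//.
have [d d0 hd] := fc p (e / 2 / (na + 1)) Pp ltac:(by rewrite !divr_gt0).
have [d' d'0 hd'] := gc p (e / 2) Pp ltac:(by rewrite divr_gt0).
exists (Num.min d d'); first by rewrite lt_min d0.
move=> s t sb tb; rewrite lt_min => /andP[st st'].
have := hd s t sb tb st; rewrite ltr_pdivlMr// => h1.
have h2 := hd' s t sb tb st'.
have -> : a *: f s + g s - (a *: f t + g t) =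
   a *: (f s - f t) + (g s - g t) by rewrite scalerBr opprD addrACA.
apply: le_lt_trans (snD _ _ Pp) _; rewrite snZK// -/na.
have := sn_ge0 (f s - f t) Pp; nra.
Qed.

Lemma ucb_ext (b : R) f g : (forall r : R, 0 <= r <= b -> f r = g r) ->
  ucb b f -> ucb b g.
Proof.
move=> fg [fc [c fb]]; split; last by exists c => t tb; rewrite -fg// fb.
move=> p e Pp e0; have [d d0 hd] := fc p e Pp e0; exists d => // s t sb tb.
by rewrite -!fg//; exact: hd.
Qed.

Lemma ucb_cst (b : R) x : ucb b (fun=> x).
Proof.
split; last by exists (nrm x).
by move=> p e Pp e0; exists 1 => // s t _ _ _; rewrite subrr sn0.
Qed.

Lemma ucbD (b : R) f g : ucb b f -> ucb b g -> ucb b (fun r => f r + g r).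
Proof.
move=> fc gc; apply: ucb_ext (ucbZD 1 fc gc) => r _.
by rewrite scale1r.
Qed.

Lemma ucbB (b : R) f g : ucb b f -> ucb b g -> ucb b (fun r => f r - g r).
Proof.
move=> fc gc; apply: ucb_ext (ucbZD (-1) gc fc) => r _.
by rewrite scaleN1r addrC.
Qed.

Lemma ucb_comp (b c : R) f (a : R -> R) :
  (forall s : R, 0 <= s <= c -> 0 <= a s <= b) ->
  (forall s t : R, 0 <= s <= c -> 0 <= t <= c -> `|a s - a t| <= `|s - t|) ->
  ucb b f -> ucb c (f \o a).
Proof.
move=> ab al [fc [k fb]]; split; last by exists k => t tc; rewrite /= fb ?ab.
move=> p e Pp e0; have [d d0 hd] := fc p e Pp e0; exists d => // s t sb tb st.
by apply: hd; rewrite ?ab//; apply: le_lt_trans st; exact: al.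
Qed.

Lemma ucb_sub (b c : R) f : c <= b -> ucb b f -> ucb c f.
Proof.
move=> cb; apply: (@ucb_comp b c f id) => // s /andP[s0 sc].
by rewrite s0 (le_trans sc).
Qed.

Lemma ucb_shift (b c s : R) f : 0 <= s -> s + c <= b -> ucb b f ->
  ucb c (fun r => f (s + r)).
Proof.
move=> s0 sc; apply: (@ucb_comp b c f (fun r => s + r)).
  by move=> r /andP[r0 rc]; apply/andP; split; lra.
by move=> r t _ _; rewrite opprD addrACA subrr add0r.
Qed.

Lemma ucb_scale (b k c : R) f (a : R -> R) : 0 <= k -> 0 <= c ->
  (forall s t : R, 0 <= s <= b -> 0 <= t <= b -> `|a s - a t| <= k * `|s - t|) ->
  (forall s : R, 0 <= s <= b -> `|a s| <= c) ->
  ucb b f -> ucb b (fun r => ofR K (a r) *: f r).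
Proof.
move=> k0 c0 al ab [fc [k' fb]]; split; last first.
  exists (c * k') => t tb; rewrite nrmZ.
  by apply: ler_pM => //; [exact: nrm_ge0|exact: ab|exact: fb].
move=> p e Pp e0.
have c1 : 0 < c + 1 by lra.
have k1 : 0 < k * `|k'| + 1 by rewrite ltr_wpDl// mulr_ge0.
have [d d0 hd] := fc p (e / 2 / (c + 1)) Pp ltac:(by rewrite !divr_gt0).
exists (Num.min d (e / 2 / (k * `|k'| + 1))).
  by rewrite lt_min d0 !divr_gt0.
move=> s t sb tb; rewrite lt_min ltr_pdivlMr// => /andP[st st'].
have := hd s t sb tb st; rewrite ltr_pdivlMr// => h1.
have -> : ofR K (a s) *: f s - ofR K (a t) *: f t =
   ofR K (a s) *: (f s - f t) + ofR K (a s - a t) *: f t.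
  by rewrite rmorphB scalerBr scalerBl subrKA.
apply: le_lt_trans (snD _ _ Pp) _; rewrite !snZ//.
have h2 : `|a s| * p (f s - f t) <= c * p (f s - f t).
  by rewrite ler_wpM2r ?ab// sn_ge0.
have h3 : `|a s - a t| * p (f t) <= (k * `|s - t|) * `|k'|.
  apply: ler_pM => //; [exact: sn_ge0|exact: al|].
  by rewrite (le_trans (sn_le_nrm _ Pp))// (le_trans (fb _ tb))// ler_norm.
have := sn_ge0 (f s - f t) Pp.
have := normr_ge0 (s - t).
nra.
Qed.

End topology.

Section primitives.
Variables (R : realType) (K : scalars R) (X : completeNormedModType K).
Variables (P : set (X -> R)) (hX : bicont_space P).
Implicit Types (p : X -> R) (x y : X) (f g G H : R -> X) (u : nat -> X).

Lemma tau_seq_lim_unique u x y :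
  tau_seq_lim P u x -> tau_seq_lim P u y -> x = y.
Proof.
move=> ux uy; apply: (sn_lt_eq hX) => p e Pp e0.
have [N hN] := ux p (e / 2) Pp ltac:(lra).
have [M hM] := uy p (e / 2) Pp ltac:(lra).
have h1 := hN (maxn N M) (leq_maxl _ _); have h2 := hM (maxn N M) (leq_maxr _ _).
have := sn_triangle hX (u (maxn N M)) x y Pp; rewrite (snC hX x (u _))//; lra.
Qed.

(** * Primitives *)

(** Mean value inequality: the interval is cut into equal steps shorter than
    [d]. *)
Lemma small_increments p (D : R -> X) (b d e : R) : P p -> 0 < d -> 0 <= e ->
  (forall s t : R, 0 <= s -> s <= t -> t <= b -> t - s < d ->
     p (D t - D s) <= e * (t - s)) ->
  forall t : R, 0 <= t <= b -> p (D t - D 0) <= e * t.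
Proof.
move=> Pp d0 e0 h t /andP[t0 tb].
pose N := (Num.truncn (t / d)).+1.
have N0 : 0 < N%:R :> R by rewrite ltr0n.
have stepd : t / N%:R < d.
  by rewrite ltr_pdivrMr// mulrC -ltr_pdivrMr// truncnS_gt.
have step0 : 0 <= t / N%:R by rewrite divr_ge0// ltW.
have Nt : N%:R * (t / N%:R) = t by rewrite mulrC divfK// gt_eqF.
suff main k : (k <= N)%N ->
    p (D (k%:R * (t / N%:R)) - D 0) <= e * (k%:R * (t / N%:R)).
  by have := main N (leqnn N); rewrite Nt.
elim: k => [_|k IH kN]; first by rewrite !mul0r mulr0 subrr (sn0 hX).
have IHk := IH (ltnW kN).
apply: le_trans (sn_triangle hX (D (k%:R * (t / N%:R))) _ _ Pp) _.
have kt : k.+1%:R * (t / N%:R) <= t.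
  by rewrite -{2}Nt ler_wpM2r// ler_nat.
have e1 : k.+1%:R * (t / N%:R) = k%:R * (t / N%:R) + t / N%:R.
  by rewrite -natr1 mulrDl mul1r.
have k0 : 0 <= k%:R * (t / N%:R) by rewrite mulr_ge0.
have := h (k%:R * (t / N%:R)) (k.+1%:R * (t / N%:R)) k0 ltac:(lra) ltac:(lra)
  ltac:(lra).
by rewrite e1; lra.
Qed.

(** [G] has derivative [g] on [[0, b]], uniformly for each seminorm. Every
    integral below is computed as an increment of such a [G]. *)
Definition prim (b : R) g G := forall p (e : R), P p -> 0 < e ->
  exists2 d : R, 0 < d & forall s xi t : R, 0 <= s -> s <= xi -> xi <= t -> t <= b ->
    t - s < d -> p (G t - G s - ofR K (t - s) *: g xi) <= e * (t - s).

End primitives.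

Section primitive_calculus.
Variables (R : realType) (K : scalars R) (X : completeNormedModType K).
Variables (P : set (X -> R)) (hX : bicont_space P).
Implicit Types (p : X -> R) (x y : X) (f g G H : R -> X) (u : nat -> X).

Lemma prim_sub (b c : R) g G : c <= b -> prim P b g G -> prim P c g G.
Proof.
move=> cb Gg p e Pp e0; have [d d0 hd] := Gg p e Pp e0; exists d => //.
by move=> s xi t s0 sx xt tc; apply: hd => //; exact: le_trans cb.
Qed.

Lemma prim_ext (b : R) f g F G : (forall r : R, 0 <= r <= b -> f r = g r) ->
  (forall r : R, 0 <= r <= b -> F r = G r) -> prim P b f F -> prim P b g G.
Proof.
move=> fg FG hF p e Pp e0; have [d d0 hd] := hF p e Pp e0; exists d => //.
move=> s xi t s0 sx xt tb td; rewrite -fg -?FG; first exact: hd.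
all: apply/andP; split; lra.
Qed.

Lemma prim_shift (b c s : R) g G : 0 <= s -> s + c <= b -> prim P b g G ->
  prim P c (fun r => g (s + r)) (fun r => G (s + r)).
Proof.
move=> s0 sc Gg p e Pp e0; have [d d0 hd] := Gg p e Pp e0; exists d => //.
move=> r xi t r0 rx xt tc td.
have := hd (s + r) (s + xi) (s + t) ltac:(lra) ltac:(lra) ltac:(lra) ltac:(lra)
  ltac:(lra).
by have -> : s + t - (s + r) = t - r by lra.
Qed.

Lemma prim_rev (b : R) g G : prim P b g G ->
  prim P b (fun r => g (b - r)) (fun r => - G (b - r)).
Proof.
move=> Gg p e Pp e0; have [d d0 hd] := Gg p e Pp e0; exists d => //.
move=> r xi t r0 rx xt tc td.
have := hd (b - t) (b - xi) (b - r) ltac:(lra) ltac:(lra) ltac:(lra) ltac:(lra)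
  ltac:(lra).
have -> : b - r - (b - t) = t - r by lra.
by rewrite opprK [- _ + _]addrC.
Qed.

Lemma primZD (b : R) (a : K) f g F G : prim P b f F -> prim P b g G ->
  prim P b (fun r => a *: f r + g r) (fun r => a *: F r + G r).
Proof.
set na := nrm (a : K^o); have na0 : 0 <= na by exact: nrm_ge0.
move=> Ff Gg p e Pp e0.
have a1 : 0 < na + 1 by rewrite ltr_wpDl.
have [d d0 hd] := Ff p (e / 2 / (na + 1)) Pp ltac:(by rewrite !divr_gt0).
have [d' d'0 hd'] := Gg p (e / 2) Pp ltac:(by rewrite divr_gt0).
exists (Num.min d d'); first by rewrite lt_min d0.
move=> s xi t s0 sx xt tb; rewrite lt_min => /andP[st st'].
have h1 := hd s xi t s0 sx xt tb st; have h2 := hd' s xi t s0 sx xt tb st'.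
have -> : a *: F t + G t - (a *: F s + G s) -
    ofR K (t - s) *: (a *: f xi + g xi) =
    a *: (F t - F s - ofR K (t - s) *: f xi) +
    (G t - G s - ofR K (t - s) *: g xi) by lincomb.
apply: le_trans (snD hX _ _ Pp) _; rewrite (snZK hX)// -/na.
set A := p _ in h1 *; set A' := p _ in h2 *.
have : na * A <= e / 2 * (t - s).
  apply: le_trans (ler_wpM2l na0 h1) _.
  have -> : na * (e / 2 / (na + 1) * (t - s)) =
    na / (na + 1) * (e / 2 * (t - s)) by field; rewrite gt_eqF.
  rewrite -[leRHS]mul1r ler_wpM2r//; last by rewrite ler_pdivrMr//; lra.
  by rewrite mulr_ge0//; lra.
lra.
Qed.

Lemma prim_opp (b : R) f F : prim P b f F ->
  prim P b (fun r => - f r) (fun r => - F r).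
Proof.
move=> Ff p e Pp e0; have [d d0 hd] := Ff p e Pp e0; exists d => //.
move=> s xi t s0 sx xt tb td.
have -> : - F t - - F s - ofR K (t - s) *: - f xi =
   - (F t - F s - ofR K (t - s) *: f xi) by lincomb.
by rewrite (snN hX)//; exact: hd.
Qed.

(** Product rule; it makes the convolution of a ramp computable. *)
Lemma prim_mul (b : R) g G : 0 <= b -> ucb P b g -> ucont P b G -> prim P b g G ->
  prim P b (fun r => ofR K r *: g r + G r) (fun r => ofR K r *: G r).
Proof.
move=> b0 [_ [c gc]] Gc Gg p e Pp e0.
have b1 : 0 < b + 1 by lra.
have c1 : 0 < `|c| + 1 by rewrite ltr_wpDl.
have [d d0 hd] := Gg p (e / 3 / (b + 1)) Pp ltac:(by rewrite !divr_gt0).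
have [d' d'0 hd'] := Gc p (e / 3) Pp ltac:(by rewrite divr_gt0).
exists (Num.min (Num.min d d') (e / 3 / (`|c| + 1))).
  by rewrite !lt_min d0 d'0/= !divr_gt0.
move=> s xi t s0 sx xt tb; rewrite !lt_min ltr_pdivlMr//.
move=> /andP[/andP[st st'] stc].
have h1 := hd s xi t s0 sx xt tb st.
have h2 := hd' s xi ltac:(apply/andP; split; lra) ltac:(apply/andP; split; lra)
  ltac:(rewrite ler0_norm; lra).
have -> : ofR K t *: G t - ofR K s *: G s -
    ofR K (t - s) *: (ofR K xi *: g xi + G xi) =
    ofR K t *: (G t - G s - ofR K (t - s) *: g xi) +
    (ofR K (t - s) *: (ofR K (t - xi) *: g xi) + ofR K (t - s) *: (G s - G xi)).
  by lincomb.
do 2 (apply: le_trans (snD hX _ _ Pp) _; rewrite -?lerBrDl).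
rewrite !(snZ hX)// (@ger0_norm _ t) ?(@ger0_norm _ (t - s))
  ?(@ger0_norm _ (t - xi)); try lra.
have gx : p (g xi) <= `|c|.
  apply: le_trans (sn_le_nrm hX _ Pp) _; apply: le_trans (ler_norm c).
  by apply: gc; apply/andP; split; lra.
have g0 := sn_ge0 hX (g xi) Pp.
have a1 : (t - xi) * p (g xi) <= e / 3.
  apply: le_trans (_ : (t - s) * (`|c| + 1) <= _); last lra.
  by apply: ler_pM => //; lra.
have a2 : t * p (G t - G s - ofR K (t - s) *: g xi) <= e / 3 * (t - s).
  apply: le_trans (ler_wpM2l (_ : 0 <= t) h1) _; first lra.
  have -> : t * (e / 3 / (b + 1) * (t - s)) =
    t / (b + 1) * (e / 3 * (t - s)) by field; rewrite gt_eqF.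
  rewrite -[leRHS]mul1r ler_wpM2r//; last by rewrite ler_pdivrMr//; lra.
  by rewrite mulr_ge0//; lra.
have ts : 0 <= t - s by lra.
have := ler_wpM2l ts a1; have := ler_wpM2l ts (ltW h2); lra.
Qed.

End primitive_calculus.

Lemma cut_mono (R : realType) (a a' s t : R) : a <= a' -> s <= t ->
  0 <= Num.min t a' - Num.min t a - (Num.min s a' - Num.min s a).
Proof.
move=> aa st; case: (leP t a') => ?; case: (leP t a) => ?; case: (leP s a') => ?;
  case: (leP s a) => ?; lra.
Qed.

Lemma cut_near (R : realType) (a a' s t : R) : a <= a' -> s <= t ->
  Num.min t a' - Num.min t a - (Num.min s a' - Num.min s a) != 0 ->
  a <= t /\ s <= a'.
Proof.
move=> aa st; case: (leP t a') => ?; case: (leP t a) => ?; case: (leP s a') => ?;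
  case: (leP s a) => ?; move=> /eqP cz; split; 
  first [lra|exfalso; apply: cz; lra].
Qed.

Section primitive_existence.
Variables (R : realType) (K : scalars R) (X : completeNormedModType K).
Variables (P : set (X -> R)) (hX : bicont_space P).
Implicit Types (p : X -> R) (x y : X) (f g G H : R -> X) (u : nat -> X).

(** * Existence of primitives *)

Section step_approximation.
Variables (b : R) (g : R -> X).
Hypotheses (b0 : 0 <= b) (hg : ucb P b g).

Let node (n i : nat) : R := i%:R * (b / n.+1%:R).

(** Length of the part of the i-th cell that lies to the left of t. *)
Let cell (n i : nat) (t : R) : R := Num.min t (node n i.+1) - Num.min t (node n i).

(** The primitive of the step function that takes on each cell of the uniform
    partition the value of [g] at its left end. *)
Definition step_prim (n : nat) (t : R) : X :=
  \sum_(i < n.+1) ofR K (cell n i t) *: g (node n i).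

Let mesh0 n : 0 <= b / n.+1%:R. Proof. by rewrite divr_ge0. Qed.

Let nodeS n i : node n i.+1 = node n i + b / n.+1%:R.
Proof. by rewrite /node -natr1 mulrDl mul1r. Qed.

Let node_itv n (i : 'I_n.+1) : 0 <= node n i <= b.
Proof.
rewrite /node mulr_ge0//= mulrCA ler_piMr// ler_pdivrMr// mul1r ler_nat.
exact: ltnW.
Qed.

Let cell_sum n (t : R) : 0 <= t <= b -> \sum_(i < n.+1) cell n i t = t.
Proof.
move=> /andP[t0 tb].
rewrite -(big_mkord xpredT (fun i => cell n i t)) telescope_sumr//.
rewrite /node mul0r mulrC divfK ?pnatr_eq0//.
by rewrite (min_l tb) (min_r t0) subr0.
Qed.

Let cell_mono n i s t : s <= t -> 0 <= cell n i t - cell n i s.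
Proof.
by move=> st; apply: cut_mono => //; rewrite nodeS lerDl mesh0.
Qed.

Let cell_near n i s t : s <= t -> cell n i t - cell n i s != 0 ->
  node n i <= t /\ s <= node n i + b / n.+1%:R.
Proof.
by move=> st; rewrite -nodeS; apply: cut_near => //; rewrite nodeS lerDl mesh0.
Qed.

Let step_prim0 n : step_prim n 0 = 0.
Proof.
rewrite /step_prim big1// => i _; rewrite /cell.
have /andP[i0 _] := node_itv i.
by rewrite !min_l ?nodeS ?addr_ge0// subrr rmorph0 scale0r.
Qed.

Let step_prim_bounded (c : R) n (t : R) : bdd_by b g c -> 0 <= t <= b ->
  nrm (step_prim n t) <= t * c.
Proof.
move=> gc tb; apply: le_trans (nrm_sum _ _) _.
rewrite -{2}(cell_sum n tb) mulr_suml; apply: ler_sum => i _.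
have c0 : 0 <= cell n i t.
  have := cell_mono n i (_ : 0 <= t); case/andP: tb => t0 _ /(_ t0).
  rewrite [cell n i 0](_ : _ = 0) ?subr0//; rewrite /cell.
  by have /andP[i0 _] := node_itv i; rewrite !min_l ?nodeS ?addr_ge0// subrr.
by rewrite nrmZ ger0_norm// ler_wpM2l// gc// node_itv.
Qed.

Let step_prim_increment p (e : R) : P p -> 0 < e -> exists2 d : R, 0 < d &
  forall n, b / n.+1%:R < d -> forall s xi t : R, 0 <= s -> s <= xi -> xi <= t ->
    t <= b -> t - s < d ->
    p (step_prim n t - step_prim n s - ofR K (t - s) *: g xi) <= e * (t - s).
Proof.
move=> Pp e0; have [d d0 hd] := hg.1 p e Pp e0.
exists (d / 2) => [|n nd s xi t s0 sx xt tb td]; first lra.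
have sb : 0 <= s <= b by apply/andP; split; lra.
have tb' : 0 <= t <= b by apply/andP; split; lra.
have xb : 0 <= xi <= b by apply/andP; split; lra.
have -> : step_prim n t - step_prim n s - ofR K (t - s) *: g xi =
  \sum_(i < n.+1) ofR K (cell n i t - cell n i s) *: (g (node n i) - g xi).
  rewrite /step_prim -{2}(cell_sum n tb') -{2}(cell_sum n sb) -!sumrB.
  rewrite raddf_sum/= scaler_suml -!sumrB; apply: eq_bigr => i _.
  by lincomb.
apply: le_trans (sn_sum hX _ _ Pp) _.
rewrite -{2}(cell_sum n tb') -{2}(cell_sum n sb) -sumrB mulr_sumr.
apply: ler_sum => i _; rewrite (snZ hX)// ger0_norm; last by apply: cell_mono; lra.
have [->|/cell_near] := eqVneq (cell n i t - cell n i s) 0.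
  by rewrite mul0r mulr0.
case; first lra.
move=> it si; rewrite mulrC ler_wpM2r//; first by apply: cell_mono; lra.
apply/ltW/hd => //.
move: (node n i) (b / n.+1%:R) it si nd => y m it si nd.
by rewrite ltr_norml; apply/andP; split; lra.
Qed.

(** The primitives of the step approximations form, at each time, a norm-bounded
    sequence that is Cauchy for every seminorm: this is where the completeness of
    bounded sets enters. *)
Lemma prim_exists : exists G, prim P b g G.
Proof.
have [c gc] := hg.2.
have c0 : 0 <= c.
  by apply: le_trans (gc 0 _); rewrite ?nrm_ge0// lexx.
have lim t : exists l, 0 <= t <= b -> tau_seq_lim P (step_prim ^~ t) l.
  have [tb|ntb] := boolP (0 <= t <= b); last by exists 0.
  have [||l /tau_seq_limP hl] := bs_complete hX (u := step_prim ^~ t);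
    last by exists l.
    by exists (t * c) => n; exact: step_prim_bounded.
  move=> p Pp e e0; have b1 : 0 < b + 1 by lra.
  have e3 : 0 < e / 3 / (b + 1) by rewrite !divr_gt0.
  have [d d0 hd] := step_prim_increment Pp e3.
  have [N hN] : exists N, forall n, (N <= n)%N -> b / n.+1%:R < d.
    exists (Num.truncn (b / d)) => n Nn.
    rewrite ltr_pdivrMr// mulrC -ltr_pdivrMr//.
    by apply: lt_le_trans (truncnS_gt _) _; rewrite ler_nat.
  exists N => m n Nm Nn.
  have := @small_increments _ _ _ _ hX p (step_prim m \- step_prim n) b d
    (2 * (e / 3 / (b + 1))) Pp d0 ltac:(lra) _ t tb.
  rewrite /= !step_prim0 subrr subr0 => h.
  apply: le_lt_trans (h _) _ => [s r s0 sr rb rd|].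
    have h1 := hd m (hN m Nm) s s r s0 (lexx _) sr rb rd.
    have h2 := hd n (hN n Nn) s s r s0 (lexx _) sr rb rd.
    have -> : step_prim m r - step_prim n r - (step_prim m s - step_prim n s) =
      step_prim m r - step_prim m s - ofR K (r - s) *: g s -
      (step_prim n r - step_prim n s - ofR K (r - s) *: g s) by lincomb.
    apply: le_trans (snB hX _ _ Pp) _; lra.
  have : t / (b + 1) <= 1 by rewrite ler_pdivrMr//; case/andP: tb; lra.
  have -> : 2 * (e / 3 / (b + 1)) * t = 2 * (e / 3) * (t / (b + 1)).
    by field; rewrite gt_eqF.
  nra.
have [G hG] := choice lim; exists G => p e Pp e0.
have [d d0 hd] := step_prim_increment Pp e0; exists d => // s xi t s0 sx xt tb td.
apply/ler_addgt0Pr => e' e'0.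
have [N1 hN1] := hG s ltac:(apply/andP; split; lra) p (e' / 2) Pp ltac:(lra).
have [N2 hN2] := hG t ltac:(apply/andP; split; lra) p (e' / 2) Pp ltac:(lra).
pose N := maxn (maxn N1 N2) (Num.truncn (b / d)).
have h1 := hN1 N ltac:(by rewrite !leq_max leqnn).
have h2 := hN2 N ltac:(by rewrite !leq_max leqnn orbT).
have Nd : b / N.+1%:R < d.
  rewrite ltr_pdivrMr// mulrC -ltr_pdivrMr//.
  by apply: lt_le_trans (truncnS_gt _) _; rewrite ler_nat ltnS leq_maxr.
have h3 := hd N Nd s xi t s0 sx xt tb td.
have -> : G t - G s - ofR K (t - s) *: g xi =
  (step_prim N t - step_prim N s - ofR K (t - s) *: g xi) +
  ((step_prim N s - G s) - (step_prim N t - G t)) by lincomb.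
apply: le_trans (snD hX _ _ Pp) _; apply: lerD => //.
apply: le_trans (snB hX _ _ Pp) _; lra.
Qed.

End step_approximation.

End primitive_existence.

(** * Riemann integrals *)

Section integral.
Variables (R : realType) (K : scalars R) (X : completeNormedModType K).
Variables (P : set (X -> R)) (hX : bicont_space P).
Implicit Types (p : X -> R) (x y : X) (f g G H : R -> X) (u : nat -> X).

Lemma is_tau_integralP g (a b : R) x : is_tau_integral P g a b x <->
  forall p (e : R), P p -> 0 < e -> exists2 d : R, 0 < d &
    forall (n : nat) (s xi : nat -> R), s 0%N = a -> s n = b ->
      (forall i, (i < n)%N ->
         [/\ s i <= xi i, xi i <= s i.+1 & s i.+1 - s i < d]) ->
      p (\sum_(i < n) ofR K (s i.+1 - s i) *: g (xi i) - x) < e.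
Proof.
split=> [h p e Pp e0|h U [n [q [e [e0 Pq qU]]]]].
  by apply: (h [set y | p (y - x) < e]); exists 1%N, (fun=> p), e; split=> // y;
    move/(_ ord0).
have : \forall d \near (0 : R)^'+, forall k : 'I_n,
    forall (n : nat) (s xi : nat -> R), s 0%N = a -> s n = b ->
      (forall i, (i < n)%N ->
         [/\ s i <= xi i, xi i <= s i.+1 & s i.+1 - s i < d]) ->
      q k (\sum_(i < n) ofR K (s i.+1 - s i) *: g (xi i) - x) < e.
  apply: filter_forall => k; have [d d0 hd] := h (q k) e (Pq k) e0.
  near=> r => m s xi sa sb hs; apply: hd => // i im.
  have [h1 h2 h3] := hs i im; split=> //; apply: lt_trans h3 _.
  by near: r; exact: nbhs_right_lt.
move=> hd.
have [d [hd' d0]] := filter_ex (filterI hd (nbhs_right_gt (0 : R))).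
by exists d => // m s xi sa sb hs; apply: qU => k; exact: hd'.
Unshelve. all: by end_near. Qed.

(** Telescoping: each term of a Riemann sum is an increment of [G] up to an error
    proportional to the length of the cell. *)
Lemma prim_tau_integral (b : R) g G : 0 <= b -> prim P b g G ->
  is_tau_integral P g 0 b (G b - G 0).
Proof.
move=> b0 Gg; apply/is_tau_integralP => p e Pp e0.
have b1 : 0 < b + 1 by lra.
have [d d0 hd] := Gg p (e / (b + 1)) Pp ltac:(by rewrite divr_gt0).
exists d => // n s xi sa sb hs.
have mono i j : (i <= j)%N -> (j <= n)%N -> s i <= s j.
  move=> ij; rewrite -(subnK ij); elim: (j - i)%N => [//|k IH] kn.
  apply: le_trans (IH (ltnW kn)) _; have [h1 h2 _] := hs _ kn.
  exact: le_trans h2.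
rewrite -sa -sb -(telescope_sumr (fun i => G (s i)))// big_mkord.
rewrite (snC hX)// -sumrB.
apply: le_lt_trans (_ : e / (b + 1) * b < e); last first.
  by rewrite mulrAC ltr_pdivrMr//; nra.
apply: le_trans (sn_sum hX _ _ Pp) _.
rewrite -{2}(subr0 b) -{2}sa -{2}sb -(telescope_sumr s)// big_mkord mulr_sumr.
apply: ler_sum => i _; have [h1 h2 h3] := hs i (ltn_ord i).
apply: hd => //.
  by rewrite -sa; apply: mono => //; exact: ltnW.
by rewrite -sb; apply: mono.
Qed.

Definition riemann_sum g (b : R) (n : nat) : X :=
  \sum_(i < n.+1) ofR K (b / n.+1%:R) *: g (i%:R * (b / n.+1%:R)).

Lemma riemann_sum_lim g (b : R) x : 0 <= b -> is_tau_integral P g 0 b x ->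
  tau_seq_lim P (riemann_sum g b) x.
Proof.
move=> b0 /is_tau_integralP h p e Pp e0; have [d d0 hd] := h p e Pp e0.
exists (Num.truncn (b / d)) => n Nn.
have m0 : 0 <= b / n.+1%:R by rewrite divr_ge0.
have md : b / n.+1%:R < d.
  rewrite ltr_pdivrMr// mulrC -ltr_pdivrMr//.
  by apply: lt_le_trans (truncnS_gt _) _; rewrite ler_nat.
have nodeS i : i.+1%:R * (b / n.+1%:R) = i%:R * (b / n.+1%:R) + b / n.+1%:R.
  by rewrite -natr1 mulrDl mul1r.
pose s i : R := i%:R * (b / n.+1%:R).
have s0 : s 0%N = 0 by rewrite /s mul0r.
have sb : s n.+1 = b by rewrite /s mulrC divfK ?pnatr_eq0.
have hs i : (i < n.+1)%N -> [/\ s i <= s i, s i <= s i.+1 & s i.+1 - s i < d].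
  by move=> _; rewrite lexx /s nodeS addrAC subrr add0r lerDl.
have := hd n.+1 s s s0 sb hs; congr (is_true (p (_ - _) < e)).
by apply: eq_bigr => i _; rewrite /s nodeS addrAC subrr add0r.
Qed.

Lemma riemann_sum_bounded g (b c : R) n : 0 <= b -> bdd_by b g c ->
  nrm (riemann_sum g b n) <= b * c.
Proof.
move=> b0 gc; apply: le_trans (nrm_sum _ _) _.
have -> : b * c = \sum_(i < n.+1) b / n.+1%:R * c.
  by rewrite sumr_const card_ord -[RHS]mulr_natr mulrAC divfK// pnatr_eq0.
apply: ler_sum => i _; rewrite nrmZ ger0_norm ?divr_ge0// ler_wpM2l ?divr_ge0//.
apply: gc; rewrite mulr_ge0 ?divr_ge0//= mulrCA ler_piMr//.
by rewrite ler_pdivrMr// mul1r ler_nat ltnW.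
Qed.

Lemma tau_integral_unique g (b : R) x y : 0 <= b ->
  is_tau_integral P g 0 b x -> is_tau_integral P g 0 b y -> x = y.
Proof.
move=> b0 /riemann_sum_lim hx /riemann_sum_lim hy.
exact: (tau_seq_lim_unique hX (hx b0) (hy b0)).
Qed.

Definition integ g (b : R) : X := xget 0 [set x | is_tau_integral P g 0 b x].

Lemma tau_integral_integ g (b : R) x : 0 <= b ->
  is_tau_integral P g 0 b x -> integ g b = x.
Proof.
by move=> b0 gx; apply: xget_unique => // y gy; exact: tau_integral_unique gy gx.
Qed.

Lemma integ_prim g G (b : R) : 0 <= b -> prim P b g G -> integ g b = G b - G 0.
Proof. by move=> b0 Gg; apply: tau_integral_integ => //; exact: prim_tau_integral. Qed.

Lemma integP g (b : R) : 0 <= b -> ucb P b g ->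
  is_tau_integral P g 0 b (integ g b).
Proof.
move=> b0 /(prim_exists hX b0)[G Gg].
by rewrite (integ_prim b0 Gg); exact: prim_tau_integral.
Qed.

Lemma integ_ext f g (b : R) : 0 <= b -> (forall r : R, 0 <= r <= b -> f r = g r) ->
  ucb P b f -> integ f b = integ g b.
Proof.
move=> b0 fg /(prim_exists hX b0)[G Gf].
by rewrite (integ_prim b0 Gf) (integ_prim b0 (prim_ext fg (fun _ _ => erefl) Gf)).
Qed.

Lemma integZD f g (a : K) (b : R) : 0 <= b -> ucb P b f -> ucb P b g ->
  integ (fun r => a *: f r + g r) b = a *: integ f b + integ g b.
Proof.
move=> b0 /(prim_exists hX b0)[F Ff] /(prim_exists hX b0)[G Gg].
rewrite (integ_prim b0 Ff) (integ_prim b0 Gg) (integ_prim b0 (primZD hX a Ff Gg)).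
by lincomb.
Qed.

Lemma integ_cat g (s c : R) : 0 <= s -> 0 <= c -> ucb P (s + c) g ->
  integ g (s + c) = integ g s + integ (fun r => g (s + r)) c.
Proof.
move=> s0 c0 /(prim_exists hX (addr_ge0 s0 c0))[G Gg].
rewrite (integ_prim (addr_ge0 s0 c0) Gg) (integ_prim s0 (prim_sub _ Gg)) ?lerDl//.
by rewrite (integ_prim c0 (prim_shift s0 (lexx _) Gg)) /= (addr0 s); lincomb.
Qed.

(** Continuity of [L] along bounded sequences is enough, since the integral is the
    limit of a bounded sequence of Riemann sums. *)
Lemma integ_map (L : X -> X) g (b : R) : 0 <= b -> linear L ->
  (forall u, seq_bounded u -> tau_seq_lim P u 0 -> tau_seq_lim P (L \o u) 0) ->
  ucb P b g -> ucb P b (L \o g) -> integ (L \o g) b = L (integ g b).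
Proof.
move=> b0 lL hL gc Lgc; have [c gb] := gc.2.
have h1 := riemann_sum_lim b0 (integP b0 gc).
apply: (tau_seq_lim_unique hX (riemann_sum_lim b0 (integP b0 Lgc))).
move=> p e Pp e0.
have [||N hN] := hL (fun n => riemann_sum g b n - integ g b) _ _ p e Pp e0.
- exists (b * c + nrm (integ g b)) => n; apply: le_trans (nrmB _ _) _.
  by rewrite lerD2r riemann_sum_bounded.
- by move=> q e' Pq e'0; have [N hN] := h1 q e' Pq e'0; exists N => n;
    rewrite subr0; exact: hN.
exists N => n /hN; rewrite subr0 /= (linB lL) /riemann_sum (lin_sum lL).
by under eq_bigr do rewrite (linZ lL).
Qed.

End integral.

(** * Bi-continuous semigroups and their generators *)

Section operator_families.
Variables (R : realType) (K : scalars R) (X : completeNormedModType K).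
Variables (P : set (X -> R)) (hX : bicont_space P).
Implicit Types (p : X -> R) (x y z : X) (f g G H : R -> X) (u : nat -> X).

Lemma bi_equi_sub (Bs Cs : set (X -> X)) : Bs `<=` Cs ->
  bi_equicontinuous P Cs -> bi_equicontinuous P Bs.
Proof.
move=> BC h u ub u0 U PU; have := h u ub u0 U PU.
by apply: filterS => n hn B /BC; exact: hn.
Qed.

(** Pointwise in [t], [F s (f s) - F t (f t)] splits into [F s (f s - f t)], small
    by bi-equicontinuity, and a variation of the orbit of [f t]. *)
Lemma ucb_apply (F : R -> X -> X) (b c : R) f :
  bi_equicontinuous P [set F t | t in `[0, b]] ->
  (forall t : R, 0 <= t <= b -> linear (F t)) ->
  (forall (t : R) x, 0 <= t <= b -> nrm (F t x) <= c * nrm x) ->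
  (forall x, ucont P b (fun t => F t x)) ->
  ucb P b f -> ucb P b (fun r => F r (f r)).
Proof.
move=> Fe Fl Fb Fc [fc [k fk]]; split; last first.
  exists (`|c| * k) => t tb; apply: le_trans (Fb _ _ tb) _.
  apply: le_trans (ler_wpM2r (nrm_ge0 _) (ler_norm c)) _.
  by rewrite ler_wpM2l// fk.
apply: (heine hX) => t tb p e Pp e0.
have [d d0 hd] := Fc (f t) p (e / 2) Pp ltac:(lra).
have [||d' d'0 hd'] := @bi_equi_uniform _ _ _ _ _ R (fun s : R => 0 <= s <= b)
    (fun s => `|s - t|) (fun s => f s - f t) (k + k) Fe _ _ p (e / 2) Pp ltac:(lra).
- by move=> s sb; apply: le_trans (nrmB _ _) _; rewrite lerD ?fk.
- move=> q e' Pq e'0; have [d' d'0 hd'] := fc q e' Pq e'0; exists d' => // s sb.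
  exact: hd'.
exists (Num.min d d') => [|s sb]; first by rewrite lt_min d0.
rewrite lt_min => /andP[sd sd'].
have h1 := hd s t sb tb sd.
have h2 : p (F s (f s - f t)) < e / 2.
  by apply: (hd' s sb sd'); exists s => //=; rewrite in_itv.
have -> : F s (f s) - F t (f t) = F s (f s - f t) + (F s (f t) - F t (f t)).
  by rewrite (linB (Fl s sb)) subrKA.
apply: le_lt_trans (snD hX _ _ Pp) _; lra.
Qed.

End operator_families.

Section semigroups.
Variables (R : realType) (K : scalars R) (X : completeNormedModType K).
Variables (P : set (X -> R)) (hX : bicont_space P).
Variables (T : R -> X -> X) (hT : bicont_semigroup P T).
Implicit Types (p : X -> R) (x y z : X) (f g G H : R -> X) (u : nat -> X).

Lemma sg_linear (t : R) : 0 <= t -> linear (T t).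
Proof. by move=> /(sg_bounded hT)[]. Qed.

Lemma sg_locally_bounded (b : R) : exists2 c : R, 0 <= c &
  forall (t : R) x, 0 <= t <= b -> nrm (T t x) <= c * nrm x.
Proof.
have [M [w [M1 hM]]] := sg_growth hT.
exists (M * expR (`|w| * b)); first by rewrite mulr_ge0 ?expR_ge0//; lra.
move=> t x /andP[t0 tb].
have M0 : 0 <= M * expR (w * t) by rewrite mulr_ge0 ?expR_ge0//; lra.
have /(opnorm_leP (sg_linear t0) M0) := hM t t0 => /(_ x) /le_trans; apply.
rewrite ler_wpM2r ?nrm_ge0// ler_wpM2l ?ler_expR//; first lra.
apply: le_trans (ler_wpM2r t0 (ler_norm w)) _.
by rewrite ler_wpM2l.
Qed.

Lemma sg_equi0 (b : R) : 0 <= b -> bi_equicontinuous P [set T t | t in `[0, b]].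
Proof.
move=> b0; apply: bi_equi_sub (sg_equi hT (_ : 0 < b + 1)); last lra.
move=> _ [t /= tb <-]; exists t => //; move: tb; rewrite /= !in_itv/=; lra.
Qed.

Lemma sg_null (t : R) u : 0 <= t -> seq_bounded u -> tau_seq_lim P u 0 ->
  tau_seq_lim P (T t \o u) 0.
Proof.
move=> t0 ub u0 p e Pp e0.
have [N hN] := (bi_equicontinuousP P _).1 (sg_equi0 t0) u ub u0 p e Pp e0.
exists N => n Nn; rewrite subr0; apply: (hN n Nn); exists t => //=.
by rewrite in_itv/= t0 lexx.
Qed.

Lemma sg_orbit (b : R) x : ucb P b (fun t => T t x).
Proof.
split; last first.
  have [c c0 hc] := sg_locally_bounded b; exists (c * nrm x) => t; exact: hc.
apply: (heine hX); apply/pcontP => t tb U PU.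
have sub s : `[0, b]%classic s -> `[0, +oo[%classic s.
  by rewrite /= !in_itv/= => /andP[->].
have := sg_cont hT (sub _ tb) PU; rewrite /= !nbhs_simpl /within /=.
by apply: filterS => s h sb; exact/h/sub.
Qed.

(** The integrand of a convolution is continuous: bi-equicontinuity makes
    [(t, x) |-> T t x] jointly continuous along bounded sets. *)
Lemma ucb_convolution (b : R) f : 0 <= b -> ucb P b f ->
  ucb P b (fun r => T (b - r) (f r)).
Proof.
move=> b0; have [c c0 hc] := sg_locally_bounded b.
have br (t : R) : 0 <= t <= b -> 0 <= b - t <= b by move=> /andP[? ?]; apply/andP; split; lra.
apply: (@ucb_apply _ _ _ _ hX (fun r => T (b - r)) b c).
- apply: bi_equi_sub (sg_equi0 b0) => _ [t tb <-]; exists (b - t) => //=.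
  by move: tb; rewrite /= !in_itv/=; exact: br.
- by move=> t /br/andP[bt _]; exact: sg_linear.
- by move=> t x /br; exact: hc.
- move=> x; have [] := @ucb_comp _ _ _ P b b _ (fun r => b - r) br _ (sg_orbit b x).
    by move=> s t _ _; rewrite opprB addrC subrKA distrC.
  by [].
Qed.

Lemma generatorP x y : generator P T x y <->
  (forall p (e : R), P p -> 0 < e -> exists2 d : R, 0 < d &
    forall h : R, 0 < h -> h < d -> p (ofR K h^-1 *: (T h x - x) - y) < e) /\
  exists C : R, forall h : R, 0 < h -> h <= 1 -> nrm (T h x - x) <= C * h.
Proof.
have bnd (C h : R) : 0 < h -> (nrm (T h x - x) / h <= C) = (nrm (T h x - x) <= C * h).
  by move=> h0; rewrite ler_pdivrMr.
split=> [[/tau_cvgP hl [C hC]]|[hl [C hC]]]; split.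
- move=> p e Pp e0; have := hl p e Pp e0.
  rewrite near_withinE => /nbhs_ballP[d /= d0 hd]; exists d => // h h0 hd'.
  by apply: hd => //; rewrite /ball/= sub0r normrN gtr0_norm.
- by exists C => h h0 h1; rewrite -bnd// hC// h0.
- apply/tau_cvgP => p e Pp e0; have [d d0 hd] := hl p e Pp e0.
  rewrite near_withinE; apply/nbhs_ballP; exists d => //= h.
  rewrite /ball/= sub0r normrN => h1 h0; apply: hd => //.
  by rewrite -(gtr0_norm h0).
- by exists C => h /andP[h0 h1]; rewrite bnd// hC.
Qed.

(** Away from 0 the difference quotients are bounded anyway, [T] being locally
    bounded. *)
Lemma generator_local (b : R) x y : 0 < b ->
  (forall p (e : R), P p -> 0 < e -> exists2 d : R, 0 < d &
    forall h : R, 0 < h -> h < d -> p (ofR K h^-1 *: (T h x - x) - y) < e) ->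
  (exists C : R, forall h : R, 0 < h -> h <= b -> nrm (T h x - x) <= C * h) ->
  generator P T x y.
Proof.
move=> b0 hl [C hC]; apply/generatorP; split=> //.
have [c c0 hc] := sg_locally_bounded 1.
exists (`|C| + (c * nrm x + nrm x) / b) => h h0 h1.
have B0 : 0 <= c * nrm x + nrm x by rewrite addr_ge0 ?mulr_ge0// nrm_ge0.
have [hb|hb] := leP h b.
  apply: le_trans (hC h h0 hb) _; rewrite ler_wpM2r ?(ltW h0)//.
  by apply: le_trans (ler_norm C) _; rewrite lerDl divr_ge0// ltW.
apply: le_trans (nrmB _ _) _.
apply: le_trans (_ : (c * nrm x + nrm x) / b * h <= _); last first.
  by rewrite ler_wpM2r ?(ltW h0)// lerDr.
rewrite mulrAC ler_pdivlMr//.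
apply: le_trans (_ : (c * nrm x + nrm x) * b <= _); last by rewrite ler_wpM2l// ltW.
by rewrite ler_wpM2r ?(ltW b0)// lerD2r hc// (ltW h0).
Qed.

Variables (J : X -> X) (hgen : forall x z, generator P T x z <-> x = J z).

(** [T s] commutes with the difference quotients of [T] and preserves their limit,
    which is taken along a bounded family. *)
Lemma sg_inv_comm (s : R) z : 0 <= s -> T s (J z) = J (T s z).
Proof.
move=> s0; apply/hgen.
have /generatorP[hl [C hC]] : generator P T (J z) z by apply/hgen.
have [c c0 hc] := sg_locally_bounded s.
have ss : 0 <= s <= s by rewrite s0 lexx.
have quo (h : R) : 0 < h -> T h (T s (J z)) - T s (J z) = T s (T h (J z) - J z).
  move=> h0; rewrite (linB (sg_linear s0)) -!(sg_add hT) ?(ltW h0)//.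
  by rewrite (addrC s h).
apply/generatorP; split; last first.
  exists (c * C) => h h0 h1; rewrite quo// -mulrA; apply: le_trans (hc _ _ ss) _.
  by rewrite ler_wpM2l// hC.
move=> p e Pp e0.
have [||d d0 hd] := @bi_equi_uniform _ _ _ _ _ R (fun h : R => 0 < h /\ h <= 1)
    id (fun h => ofR K h^-1 *: (T h (J z) - J z) - z) (C + nrm z) (sg_equi0 s0) _ _
    p e Pp e0.
- move=> h [h0 h1]; apply: le_trans (nrmB _ _) _; rewrite lerD2r nrmZ.
  rewrite gtr0_norm ?invr_gt0// mulrC ler_pdivrMr//; exact: hC.
- by move=> q e' Pq e'0; have [d d0 hd] := hl q e' Pq e'0; exists d => // h [h0 _];
    exact: hd.
exists (Num.min d 1); first by rewrite lt_min d0 ltr01.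
move=> h h0; rewrite lt_min => /andP[hd' h1].
have -> : ofR K h^-1 *: (T h (T s (J z)) - T s (J z)) - T s z =
    T s (ofR K h^-1 *: (T h (J z) - J z) - z).
  by rewrite quo// -(linZ (sg_linear s0)) -(linB (sg_linear s0)).
apply: (hd h _ hd'); first by rewrite (ltW h1).
by exists s => //=; rewrite in_itv.
Qed.

(** The difference quotients at [J z] tend to [z], and bi-equicontinuity transports
    this convergence uniformly along the orbit. *)
Lemma prim_orbit (b : R) z : 0 <= b ->
  prim P b (fun t => T t z) (fun t => T t (J z)).
Proof.
move=> b0 p e Pp e0.
have /generatorP[hl [C hC]] : generator P T (J z) z by apply/hgen.
have [||d d0 hd] := @bi_equi_uniform _ _ _ _ _ R (fun h : R => 0 < h /\ h <= 1)
    id (fun h => ofR K h^-1 *: (T h (J z) - J z) - z) (C + nrm z) (sg_equi0 b0) _ _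
    p (e / 2) Pp ltac:(lra).
- move=> h [h0 h1]; apply: le_trans (nrmB _ _) _; rewrite lerD2r nrmZ.
  rewrite gtr0_norm ?invr_gt0// mulrC ler_pdivrMr//; exact: hC.
- by move=> q e' Pq e'0; have [d d0 hd] := hl q e' Pq e'0; exists d => // h [h0 _];
    exact: hd.
have [d' d'0 hd'] := (sg_orbit b z).1 p (e / 2) Pp ltac:(lra).
exists (Num.min (Num.min d d') 1); first by rewrite !lt_min d0 d'0 ltr01.
move=> s xi t s0 sx xt tb; rewrite !lt_min => /andP[/andP[td td'] t1].
have [ts|ts] := leP t s.
  have -> : s = t by lra.
  by rewrite !subrr rmorph0 scale0r subrr (sn0 hX)// mulr0.
pose h := t - s; have h0 : 0 < h by rewrite /h; lra.
have th : t = s + h by rewrite /h; lra.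
have -> : T t (J z) - T s (J z) - ofR K (t - s) *: T xi z =
   ofR K h *: (T s (ofR K h^-1 *: (T h (J z) - J z) - z) + (T s z - T xi z)).
  have sl := sg_linear s0.
  have -> : T t (J z) = T s (T h (J z)) by rewrite [in LHS]th (sg_add hT)// ltW.
  rewrite -/h !(linB sl) (linZ sl) (linB sl).
  rewrite scalerDr scalerBr scalerA -rmorphM mulfV ?gt_eqF// rmorph1 scale1r.
  by lincomb.
rewrite (snZ hX)// gtr0_norm// mulrC ler_wpM2r ?(ltW h0)//.
apply: le_trans (snD hX _ _ Pp) _.
have h1 : p (T s (ofR K h^-1 *: (T h (J z) - J z) - z)) < e / 2.
  apply: (hd h) => //; first by split=> //; rewrite /h; lra.
  by exists s => //=; rewrite in_itv/=; lra.
have h2 := hd' s xi ltac:(lra) ltac:(lra) ltac:(rewrite ler0_norm; lra).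
lra.
Qed.

End semigroups.

(** * Convolution with the semigroup *)

Section convolution.
Variables (R : realType) (K : scalars R) (X : completeNormedModType K).
Variables (P : set (X -> R)) (hX : bicont_space P).
Variables (T : R -> X -> X) (hT : bicont_semigroup P T).
Variables (J : X -> X) (lJ : linear J).
Hypothesis hgen : forall x z, generator P T x z <-> x = J z.
Variables (C : X -> X) (lC : linear C).
Hypothesis C_ucb : forall (b : R) f, ucb P b f -> ucb P b (C \o f).
Implicit Types (p q : X -> R) (x y z : X) (f g : R -> X).

Lemma inv_injective : injective J.
Proof.
move=> y z yz.
have /generatorP[// hy _] : generator P T (J y) y by apply/hgen.
have /generatorP[// hz _] : generator P T (J y) z by apply/hgen.
apply: (sn_lt_eq hX) => p e Pp e0.
have [d d0 hd] := hy p (e / 2) Pp ltac:(lra).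
have [d' d'0 hd'] := hz p (e / 2) Pp ltac:(lra).
pose h := Num.min d d' / 2.
have m0 : 0 < Num.min d d' by rewrite lt_min d0.
have h0 : 0 < h by rewrite /h; lra.
have : h < Num.min d d' by rewrite /h; lra.
rewrite lt_min => /andP[h1 h2].
have := hd h h0 h1; have := hd' h h0 h2.
set w := ofR K h^-1 *: _ => a1 a2.
have := sn_triangle hX w y z Pp; rewrite (snC hX y w)//; lra.
Qed.

Lemma generator_inv_lim z p (e : R) : P p -> 0 < e -> exists2 d : R, 0 < d &
  forall h : R, 0 < h -> h < d -> p (ofR K h^-1 *: (T h (J z) - J z) - z) < e.
Proof.
have /generatorP[// h _] : generator P T (J z) z by apply/hgen.
exact: h.
Qed.

Definition sgconv f (t : R) : X := integ P (fun r => T (t - r) (C (f r))) t.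

Lemma ucb_conv (t : R) f : 0 <= t -> ucb P t f ->
  ucb P t (fun r => T (t - r) (C (f r))).
Proof. by move=> tge0 fc; apply: (ucb_convolution hX hT) => //; exact: C_ucb. Qed.

Lemma conv_ext (t : R) f g : 0 <= t -> (forall r : R, 0 <= r <= t -> f r = g r) ->
  ucb P t f -> sgconv f t = sgconv g t.
Proof.
move=> tge0 fg fc; apply: (integ_ext hX) => //; last exact: ucb_conv.
by move=> r /fg ->.
Qed.

Lemma convZD (t : R) (a : K) f g : 0 <= t -> ucb P t f -> ucb P t g ->
  sgconv (fun r => a *: f r + g r) t = a *: sgconv f t + sgconv g t.
Proof.
move=> tge0 fc gc; rewrite -(integZD hX)//; try exact: ucb_conv.
apply: (integ_ext hX) => //; last by apply: ucb_conv => //; exact: ucbZD.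
move=> r /andP[r0 rt]; have tr : 0 <= t - r by lra.
by rewrite lC (sg_linear hT tr).
Qed.

(** Splitting the integral at time [s]: what has been accumulated until then evolves
    under the semigroup. *)
Lemma conv_cat (s c : R) f : 0 <= s -> 0 <= c -> ucb P (s + c) f ->
  sgconv f (s + c) = T c (sgconv f s) + sgconv (fun r => f (s + r)) c.
Proof.
move=> s0 c0 fc; have sc0 := addr_ge0 s0 c0.
rewrite /sgconv (integ_cat hX s0 c0 (ucb_conv sc0 fc)); congr (_ + _); last first.
  by congr integ; apply/funext => r; congr (T _ _); lra.
have fs : ucb P s f by apply: ucb_sub fc; rewrite lerDl.
have e1 (r : R) : 0 <= r <= s -> T (s + c - r) (C (f r)) =
    (T c \o (fun r => T (s - r) (C (f r)))) r.
  move=> /andP[r0 rs]; rewrite /= -(sg_add hT) ?subr_ge0//.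
  by congr (T _ _); lra.
have uc : ucb P s (fun r => T (s + c - r) (C (f r))).
  by apply: ucb_sub (ucb_conv sc0 fc); rewrite lerDl.
rewrite (integ_ext hX s0 e1 uc); apply: (integ_map hX s0 (sg_linear hT c0)).
- by move=> u; exact: (sg_null hT c0).
- exact: ucb_conv.
- exact: ucb_ext e1 uc.
Qed.

Lemma prim_orbit_rev (t : R) z : 0 <= t ->
  prim P t (fun r => T (t - r) z) (fun r => - T (t - r) (J z)).
Proof. by move=> tge0; exact: prim_rev (prim_orbit hX hT hgen z tge0). Qed.

Lemma conv_cst (t : R) x : 0 <= t -> sgconv (fun=> x) t = J (T t (C x) - C x).
Proof.
move=> tge0; rewrite /sgconv (integ_prim hX tge0 (prim_orbit_rev (C x) tge0)).
rewrite subr0 subrr (sg_zero hT) (sg_inv_comm hT hgen)// (linB lJ).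
by lincomb.
Qed.

(** Integration by parts: the second primitive of the orbit of [z] is the orbit of
    [J (J z)]. *)
Lemma conv_ramp (t : R) x : 0 <= t ->
  sgconv (fun r => ofR K r *: x) t = J (J (T t (C x) - C x) - ofR K t *: C x).
Proof.
move=> tge0; set z := C x.
have sub : ucb P t (fun r => T (t - r) z).
  exact: (@ucb_conv t (fun=> x) tge0 (ucb_cst hX t x)).
have Gc : ucont P t (fun r => - T (t - r) (J z)).
  have [] : ucb P t (fun r => 0 - T (t - r) (J z)).
    by apply: (ucbB hX) (ucb_cst hX _ _) _; apply: (ucb_convolution hX hT) => //;
      exact: ucb_cst.
  by move=> h _ p e Pp e0; have [d d0 hd] := h p e Pp e0; exists d => // s r sb rb;
    move/(hd s r sb rb); rewrite !sub0r.
have F1 := prim_mul hX tge0 sub Gc (prim_orbit_rev z tge0).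
have F2 := primZD hX (-1) (prim_opp hX (prim_orbit_rev (J z) tge0)) F1.
have F3 : prim P t (fun r => T (t - r) (C (ofR K r *: x))) (fun r =>
    (-1) *: - - T (t - r) (J (J z)) + ofR K r *: - T (t - r) (J z)).
  apply: prim_ext F2 => // r /andP[r0 rt].
  rewrite (linZ lC) (linZ (sg_linear hT _)) ?subr_ge0//; lincomb.
rewrite /sgconv (integ_prim hX tge0 F3) subr0 subrr !(sg_zero hT) !(linB lJ) (linZ lJ).
rewrite -!(sg_inv_comm hT hgen)//; lincomb.
Qed.

End convolution.

(** * Ramps in front of a function *)

Definition clamp01 (R : realType) (r : R) : R := Num.min 1 (Num.max 0 r).

Lemma clamp01_itv (R : realType) (r : R) : 0 <= clamp01 r <= 1.
Proof.
by rewrite /clamp01 le_min ler01 le_max lexx ge_min lexx.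
Qed.

Lemma clamp01_le0 (R : realType) (r : R) : r <= 0 -> clamp01 r = 0.
Proof. by move=> r0; rewrite /clamp01 (max_l r0) min_r. Qed.

Lemma clamp01_ge1 (R : realType) (r : R) : 1 <= r -> clamp01 r = 1.
Proof. by move=> r1; rewrite /clamp01 max_r ?min_l// (le_trans ler01). Qed.

Lemma clamp01_id (R : realType) (r : R) : 0 <= r <= 1 -> clamp01 r = r.
Proof. by move=> /andP[r0 r1]; rewrite /clamp01 max_r// min_r. Qed.

Lemma clamp01_lip (R : realType) (r s : R) : `|clamp01 r - clamp01 s| <= `|r - s|.
Proof.
wlog rs : r s / s <= r.
  by move=> h; have [/h//|/ltW/h] := leP s r; rewrite distrC (distrC s).
rewrite (@ger0_norm _ (r - s)) ?subr_ge0// ler_norml /clamp01.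
case: (leP 0 r) => ?; case: (leP 0 s) => ?; rewrite ?(min_r ler01);
  case: (leP 1 r) => ?; case: (leP 1 s) => ?; apply/andP; split; lra.
Qed.

Lemma max0_lip (R : realType) (r s a : R) :
  `|Num.max (r - a) 0 - Num.max (s - a) 0| <= `|r - s|.
Proof.
wlog rs : r s / s <= r.
  by move=> h; have [/h//|/ltW/h] := leP s r; rewrite distrC (distrC s).
rewrite (@ger0_norm _ (r - s)) ?subr_ge0// ler_norml.
case: (leP (r - a) 0) => ?; case: (leP (s - a) 0) => ?;
  apply/andP; split; lra.
Qed.

Section control_operator.
Variables (R : realType) (K : scalars R) (X : completeNormedModType K).
Variables (P : set (X -> R)) (hX : bicont_space P).
Variables (T : R -> X -> X) (hT : bicont_semigroup P T).
Variables (J : X -> X) (lJ : linear J).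
Hypothesis hgen : forall x z, generator P T x z <-> x = J z.
Variables (C : X -> X) (lC : linear C).
Hypothesis C_ucb : forall (b : R) f, ucb P b f -> ucb P b (C \o f).
Implicit Types (p q : X -> R) (x y z : X) (f g : R -> X).

Let sgconv := sgconv P T C.

(** The extension preceding [f], read from time [b - t] on, by a ramp of length
    [d] from 0 up to [f 0]. *)
Definition ramp_extension (t b d : R) f (r : R) : X :=
  ofR K (clamp01 (1 + (r - (b - t)) / d)) *: f (Num.max (r - (b - t)) 0).

Lemma ucb_ramp_extension (t b d : R) f : 0 <= t -> t <= b -> 0 < d ->
  ucb P t f -> ucb P b (ramp_extension t b d f).
Proof.
move=> t0 tb d0 fc.
apply: (@ucb_scale _ _ _ _ hX b d^-1 1) => //.
- by rewrite invr_ge0 ltW.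
- move=> r s _ _; apply: le_trans (clamp01_lip _ _) _.
  have -> : 1 + (r - (b - t)) / d - (1 + (s - (b - t)) / d) = d^-1 * (r - s).
    by field; rewrite gt_eqF.
  by rewrite normrM gtr0_norm ?invr_gt0.
- by move=> r _; have /andP[c0 c1] := clamp01_itv (1 + (r - (b - t)) / d); rewrite ger0_norm.
- apply: (@ucb_comp _ _ _ P t b f (fun r => Num.max (r - (b - t)) 0)) => //.
    by move=> r /andP[r0 rb]; case: (leP (r - (b - t)) 0) => ?; apply/andP; split; lra.
  by move=> r s _ _; exact: max0_lip.
Qed.

Lemma ramp_extension_values (t b d : R) f (r : R) : 0 <= t -> 0 <= r <= b ->
  exists2 s : R, 0 <= s <= t & exists2 l : R, 0 <= l <= 1 &
    ramp_extension t b d f r = ofR K l *: f s.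
Proof.
move=> t0 /andP[r0 rb]; exists (Num.max (r - (b - t)) 0).
  by case: (leP (r - (b - t)) 0) => ?; apply/andP; split; lra.
by exists (clamp01 (1 + (r - (b - t)) / d)) => //; exact: clamp01_itv.
Qed.

(** The part of the convolution produced by the ramp is, up to [J], a difference
    quotient of [T] minus its limit, hence disappears as the ramp shortens. *)
Lemma conv_ramp_extension (t b d : R) f : 0 <= t -> 0 < d -> d <= b - t ->
  ucb P t f -> let z := T t (C (f 0)) in
  sgconv (ramp_extension t b d f) b =
    sgconv f t + J (ofR K d^-1 *: (T d (J z) - J z) - z).
Proof.
move=> t0 d0 db fc z; set F := ramp_extension t b d f.
have Fc : ucb P b F by apply: ucb_ramp_extension => //; lra.
have c1 : 0 <= b - t by lra.
have c2 : 0 <= b - t - d by lra.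
have bE : b = (b - t) + t by lra.
have btE : b - t = (b - t - d) + d by lra.
have Fc' : ucb P (b - t) F by apply: ucb_sub Fc; lra.
have -> : sgconv F b = T t (sgconv F (b - t)) + sgconv (fun r => F (b - t + r)) t.
  by rewrite {1}bE; apply: (conv_cat hX hT) => //; rewrite -bE.
have -> : sgconv (fun r => F (b - t + r)) t = sgconv f t.
  apply: (conv_ext hX hT) => //; last first.
    by apply: (ucb_shift c1 _ Fc); lra.
  move=> r /andP[r0 rt]; rewrite /F /ramp_extension.
  have -> : b - t + r - (b - t) = r by lra.
  rewrite max_l// clamp01_ge1 ?rmorph1 ?scale1r//.
  by rewrite lerDl divr_ge0// ltW.
have -> : sgconv F (b - t) = T d (sgconv F (b - t - d)) +
    sgconv (fun r => F (b - t - d + r)) d.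
  by rewrite {1}btE; apply: (conv_cat hX hT) => //; [exact: ltW|rewrite -btE].
have -> : sgconv F (b - t - d) = 0.
  have := conv_cst hX hT lJ hgen C 0 c2.
  rewrite (lin0 lC) (lin0 (sg_linear hT c2)) subrr (lin0 lJ) => <-.
  apply: (conv_ext hX hT) => //; last by apply: ucb_sub Fc; lra.
  move=> r /andP[r0 rc]; rewrite /F /ramp_extension.
  rewrite clamp01_le0 ?rmorph0 ?scale0r//.
  by rewrite addrC -lerBrDr sub0r ler_pdivrMr//; lra.
have -> : sgconv (fun r => F (b - t - d + r)) d =
    sgconv (fun r => ofR K r *: (ofR K d^-1 *: f 0)) d.
  apply: (conv_ext hX hT) => //; first exact: ltW.
    move=> r /andP[r0 rd]; rewrite /F /ramp_extension.
    have -> : b - t - d + r - (b - t) = r - d by lra.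
    rewrite max_r; last lra.
    have -> : 1 + (r - d) / d = r / d by field; rewrite gt_eqF.
    rewrite clamp01_id; last by rewrite divr_ge0 ?(ltW d0)//= ler_pdivrMr// mul1r.
    by rewrite scalerA -rmorphM.
  by apply: (ucb_shift c2 _ Fc); lra.
have sc := conv_ramp hX hT lJ hgen lC C_ucb (ofR K d^-1 *: f 0) (ltW d0).
rewrite /sgconv sc; set y := C (f 0) in z *.
have dd : 0 <= d by exact: ltW.
rewrite (lin0 (sg_linear hT dd)) add0r (sg_inv_comm hT hgen)//.
rewrite addrC; congr (_ + J _).
rewrite (linZ lC) -/y !(linZ (sg_linear hT dd)).
rewrite (linB (sg_linear hT t0)) (sg_inv_comm hT hgen)//.
have lt0 := sg_linear hT t0.
rewrite -scalerBr !(linZ lt0) (linZ lJ) scalerA -rmorphM mulfV ?gt_eqF//.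
rewrite rmorph1 scale1r -/z; congr (_ *: _ - _).
rewrite (linB lt0) (linB lJ); congr (_ - _).
by rewrite (sg_inv_comm hT hgen)// /z -!(sg_add hT)// addrC.
Qed.

End control_operator.

(** * The operator V_B on all shorter intervals *)

Section admissible_operator.
Variables (R : realType) (K : scalars R) (X : completeNormedModType K).
Variables (P : set (X -> R)) (hX : bicont_space P).
Variables (T : R -> X -> X) (hT : bicont_semigroup P T).
Variables (J : X -> X) (lJ : linear J).
Hypothesis hgen : forall x z, generator P T x z <-> x = J z.
Variables (C : X -> X) (lC : linear C).
Hypothesis C_ucb : forall (b : R) f, ucb P b f -> ucb P b (C \o f).
Variables (t0 M : R).
Implicit Types (p q : X -> R) (x y z : X) (f g : R -> X).

Let conv := sgconv P T C.

Hypothesis adm_range : forall f, ucb P t0 f -> exists y, conv f t0 = J y.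
Hypothesis adm_tau : forall (e : R) p, 0 < e -> P p -> exists q (k : R),
  [/\ P q, 0 < k & forall f y (a b : R), ucb P t0 f -> conv f t0 = J y ->
    (forall r : R, 0 <= r <= t0 -> q (f r) <= a) -> bdd_by t0 f b ->
    p y <= k * a + e * b].
Hypothesis adm_norm : forall f y (b : R), ucb P t0 f -> conv f t0 = J y ->
  bdd_by t0 f b -> nrm y <= M * b.

(** The value at time [t] of the operator [V_B] applied to [f]: [J] inverts the
    generator, so this is the generator applied to the convolution. *)
Definition ctrl f (t : R) : X := xget 0 [set y | conv f t = J y].

Lemma ctrl_eq f (t : R) y : conv f t = J y -> ctrl f t = y.
Proof.
move=> fy; apply: xget_unique => // z /= fz.
by apply: (inv_injective hX hgen); rewrite -fz.
Qed.

Let ramp_quo (t d : R) f : X :=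
  let z := T t (C (f 0)) in ofR K d^-1 *: (T d (J z) - J z) - z.

Lemma conv_ramp_ctrl (t d : R) f y : 0 <= t -> 0 < d -> d <= t0 - t -> ucb P t f ->
  conv (ramp_extension t t0 d f) t0 = J y -> conv f t = J (y - ramp_quo t d f).
Proof.
move=> tge0 d0 dt fc; rewrite /conv (conv_ramp_extension hX hT lJ hgen lC C_ucb)//.
by move=> /(canRL (addrK _)) ->; rewrite -(linB lJ).
Qed.

Lemma ctrlP (t : R) f : 0 <= t <= t0 -> ucb P t f -> conv f t = J (ctrl f t).
Proof.
move=> /andP[tge0 tt0] fc; suff [y fy] : exists y, conv f t = J y.
  by rewrite (ctrl_eq fy).
have [tt|tt] := leP t0 t; last first.
  have d0 : 0 < t0 - t by lra.
  have [y hy] := adm_range (ucb_ramp_extension hX tge0 tt0 d0 fc).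
  by exists (y - ramp_quo t (t0 - t) f); exact: conv_ramp_ctrl hy.
have tE : t = t0 by lra.
by rewrite tE in fc *; exact: adm_range.
Qed.

(** At [t0] this is the hypothesis. At an earlier time the hypothesis is applied to
    [ramp_extension], which satisfies the same bounds as [f]; the part due to the
    ramp tends to 0 as its length does. *)
Lemma ctrl_sn (e : R) p : 0 < e -> P p -> exists q (k : R),
  [/\ P q, 0 < k & forall f (t a b : R), 0 <= t <= t0 -> ucb P t f ->
    (forall r : R, 0 <= r <= t -> q (f r) <= a) -> bdd_by t f b ->
    p (ctrl f t) <= k * a + e * b].
Proof.
move=> e0 Pp; have [q [k [Pq k0 hq]]] := adm_tau e0 Pp.
exists q, k; split=> // f t a b tt fc fa fb; have /andP[tge0 tt0] := tt.
have [tt'|tt'] := leP t0 t.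
  have tE : t = t0 by lra.
  by rewrite tE in tt fc fa fb *; apply: hq fa fb => //; exact: ctrlP.
apply/ler_addgt0Pr => e' e'0.
have [d d0 hd] := generator_inv_lim hgen (T t (C (f 0))) Pp e'0.
pose h := Num.min (d / 2) (t0 - t).
have h0 : 0 < h by rewrite lt_min; apply/andP; split; lra.
have hd2 : h < d by rewrite gt_min; apply/orP; left; lra.
have ht : h <= t0 - t by rewrite ge_min lexx orbT.
have Fc := ucb_ramp_extension hX tge0 tt0 h0 fc.
have [y hy] := adm_range Fc.
rewrite (ctrl_eq (conv_ramp_ctrl tge0 h0 ht fc hy)).
apply: le_trans (snB hX _ _ Pp) _; apply: lerD; last exact/ltW/hd.
apply: hq Fc hy _ _ => r rt.
  have [s st [l /andP[l0 l1] ->]] := ramp_extension_values h f tge0 rt.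
  rewrite (snZ hX)// ger0_norm//; apply: le_trans (fa s st).
  by rewrite ler_piMl// (sn_ge0 hX).
have [s st [l /andP[l0 l1] ->]] := ramp_extension_values h f tge0 rt.
rewrite nrmZ ger0_norm//; apply: le_trans (fb s st).
by rewrite ler_piMl// nrm_ge0.
Qed.

(** Same argument as for [ctrl_sn]: the norm is a supremum of seminorms, so the bound
    [M] survives the limit and no constant is lost at times before [t0]. *)
Lemma ctrl_nrm f (t b : R) : 0 <= t <= t0 -> ucb P t f -> bdd_by t f b ->
  nrm (ctrl f t) <= M * b.
Proof.
move=> tt fc fb; have /andP[tge0 tt0] := tt.
have [tt'|tt'] := leP t0 t.
  have tE : t = t0 by lra.
  by rewrite tE in tt fc fb *; apply: adm_norm fb => //; exact: ctrlP.
apply: (nrm_le_eps hX) => p e' Pp e'0.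
have [d d0 hd] := generator_inv_lim hgen (T t (C (f 0))) Pp e'0.
pose h := Num.min (d / 2) (t0 - t).
have h0 : 0 < h by rewrite lt_min; apply/andP; split; lra.
have hd2 : h < d by rewrite gt_min; apply/orP; left; lra.
have ht : h <= t0 - t by rewrite ge_min lexx orbT.
have Fc := ucb_ramp_extension hX tge0 tt0 h0 fc.
have [y hy] := adm_range Fc.
rewrite (ctrl_eq (conv_ramp_ctrl tge0 h0 ht fc hy)).
apply: le_trans (snB hX _ _ Pp) _; apply: lerD; last exact/ltW/hd.
apply: le_trans (sn_le_nrm hX _ Pp) _; apply: adm_norm Fc hy _ => r rt.
have [s st [l /andP[l0 l1] ->]] := ramp_extension_values h f tge0 rt.
rewrite nrmZ ger0_norm//; apply: le_trans (fb s st).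
by rewrite ler_piMl// nrm_ge0.
Qed.

Lemma ctrlZD (t : R) (a : K) f g : 0 <= t <= t0 -> ucb P t f -> ucb P t g ->
  ctrl (fun r => a *: f r + g r) t = a *: ctrl f t + ctrl g t.
Proof.
move=> tt fc gc; have /andP[tge0 _] := tt; apply: ctrl_eq.
by rewrite lJ -!ctrlP//; exact: convZD.
Qed.

Lemma ctrlB (t : R) f g : 0 <= t <= t0 -> ucb P t f -> ucb P t g ->
  ctrl (fun r => f r - g r) t = ctrl f t - ctrl g t.
Proof.
move=> tt fc gc; have := ctrlZD (-1) tt gc fc.
rewrite scaleN1r addrC => <-; congr ctrl; apply/funext => r.
by rewrite scaleN1r addrC.
Qed.

Lemma ctrl_ext (t : R) f g : 0 <= t -> (forall r : R, 0 <= r <= t -> f r = g r) ->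
  ucb P t f -> ctrl f t = ctrl g t.
Proof. by move=> tge0 fg fc; rewrite /ctrl /conv (conv_ext hX hT C_ucb tge0 fg fc). Qed.

Lemma ctrl_cst (t : R) x : 0 <= t -> ctrl (fun=> x) t = T t (C x) - C x.
Proof. by move=> tge0; apply: ctrl_eq; exact: conv_cst. Qed.

Lemma ctrl_ramp (t : R) x : 0 <= t ->
  ctrl (fun r => ofR K r *: x) t = J (T t (C x) - C x) - ofR K t *: C x.
Proof. by move=> tge0; apply: ctrl_eq; exact: conv_ramp. Qed.

Lemma ctrl_cat (s c : R) f : 0 <= s -> 0 <= c -> s + c <= t0 -> ucb P (s + c) f ->
  ctrl f (s + c) = T c (ctrl f s) + ctrl (fun r => f (s + r)) c.
Proof.
move=> s0 c0 sc fc; apply: ctrl_eq.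
have fs : ucb P s f by apply: ucb_sub fc; lra.
have fs' : ucb P c (fun r => f (s + r)) by apply: (ucb_shift s0 _ fc).
rewrite /conv (conv_cat hX hT C_ucb s0 c0 fc) -!/conv (linD lJ).
rewrite -(sg_inv_comm hT hgen)// -!ctrlP//; apply/andP; split; lra.
Qed.

(** [ctrl f] at two times differs by [ctrl] of the difference of [f] and a
    translate of [f], which is small by uniform continuity of [f]. *)
Lemma ucb_ctrl (b : R) f : 0 <= b <= t0 -> ucb P b f -> ucb P b (ctrl f).
Proof.
move=> /andP[b0 bt0] fc; have [c fb] := fc.2; split; last first.
  exists (M * c) => t /andP[tge0 tb]; apply: ctrl_nrm => //.
  - by rewrite tge0 (le_trans tb).
  - exact: ucb_sub fc.
  - by move=> r /andP[r0 rt]; apply: fb; rewrite r0 (le_trans rt).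
have c0 : 0 <= c by apply: le_trans (nrm_ge0 (f 0)) (fb 0 _); rewrite lexx.
have step (s t : R) : 0 <= s -> s <= t -> t <= b ->
    ctrl f t - ctrl f s =
    ctrl (fun r => f r - f (Num.max (r - (t - s)) 0)) t +
    (T t (C (f 0)) - T s (C (f 0))).
  move=> s0 st tb; set f' := fun r => f (Num.max (r - (t - s)) 0).
  have tge0 : 0 <= t by lra.
  have tt : 0 <= t <= t0 by apply/andP; split; lra.
  have ft : ucb P t f by apply: ucb_sub fc.
  have f'c : ucb P t f'.
    apply: (@ucb_comp _ _ _ P t t f (fun r => Num.max (r - (t - s)) 0)) => //.
      by move=> r /andP[r0 rt]; case: (leP (r - (t - s)) 0) => ?; apply/andP; split; lra.
    by move=> r r' _ _; exact: max0_lip.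
  have ts : 0 <= t - s by lra.
  have tE : t = (t - s) + s by lra.
  rewrite (ctrlB tt ft f'c).
  have -> : ctrl f' t = T s (ctrl f' (t - s)) + ctrl (fun r => f' (t - s + r)) s.
    by rewrite {1}tE; apply: ctrl_cat => //; rewrite -tE//; lra.
  have -> : ctrl (fun r => f' (t - s + r)) s = ctrl f s.
    apply: ctrl_ext => //; last by apply: (ucb_shift ts _ f'c); lra.
    move=> r /andP[r0 rs]; rewrite /f'; congr f.
    have -> : t - s + r - (t - s) = r by lra.
    by rewrite max_l.
  have -> : ctrl f' (t - s) = T (t - s) (C (f 0)) - C (f 0).
    rewrite -ctrl_cst//; apply: ctrl_ext => //; last by apply: ucb_sub f'c; lra.
    by move=> r /andP[r0 rs]; rewrite /f' max_r//; lra.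
  rewrite (linB (sg_linear hT s0)) -(sg_add hT)//.
  have -> : s + (t - s) = t by lra.
  by lincomb.
move=> p e Pp e0.
have ce : 0 < 2 * c + 1 by lra.
have e4 : 0 < e / 4 / (2 * c + 1) by rewrite !divr_gt0.
have [q [k [Pq k0 hq]]] := ctrl_sn e4 Pp.
have [d d0 hd] := fc.1 q (e / 4 / k) Pq ltac:(by rewrite !divr_gt0).
have [d' d'0 hd'] := (sg_orbit hX hT b (C (f 0))).1 p (e / 4) Pp ltac:(lra).
exists (Num.min d d'); first by rewrite lt_min d0.
move=> s t sb tb.
wlog st : s t sb tb / s <= t.
  move=> h; have [/h|/ltW/h] := leP s t; first exact.
  by move=> h' st; rewrite (snC hX)//; apply: h' => //; rewrite distrC.
rewrite lt_min => /andP[sd sd'].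
have /andP[s0 s1] := sb; have /andP[tge0 t1] := tb.
rewrite (snC hX)// step//.
have h1 := hd' t s tb sb ltac:(by rewrite distrC).
apply: le_lt_trans (snD hX _ _ Pp) _.
have tsd : t - s < d by move: sd; rewrite ler0_norm; lra.
have mx (r : R) : 0 <= r <= t -> 0 <= Num.max (r - (t - s)) 0 <= b.
  by move=> /andP[r0 rt]; case: (leP (r - (t - s)) 0) => ?; apply/andP; split; lra.
have : p (ctrl (fun r => f r - f (Num.max (r - (t - s)) 0)) t) <=
    k * (e / 4 / k) + e / 4 / (2 * c + 1) * (2 * c).
  apply: hq.
  - by apply/andP; split; lra.
  - apply: (ucbB hX); first exact: ucb_sub fc.
    apply: (@ucb_comp _ _ _ P b t f (fun r => Num.max (r - (t - s)) 0)) => //.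
    by move=> r r' _ _; exact: max0_lip.
  - move=> r rt; have /andP[r0 rt'] := rt; apply/ltW/hd; [lra|exact: mx|].
    by case: (leP (r - (t - s)) 0) => ?; rewrite ger0_norm; lra.
  - move=> r rt; have /andP[r0 rt'] := rt; apply: le_trans (nrmB _ _) _.
    by have := fb _ (mx r rt); have := fb r ltac:(lra); lra.
have -> : k * (e / 4 / k) = e / 4 by field; rewrite gt_eqF.
have : e / 4 / (2 * c + 1) * (2 * c) <= e / 4.
  by rewrite mulrAC -mulrA ler_piMr//; [lra|rewrite ler_pdivrMr//; lra].
lra.
Qed.

End admissible_operator.

Lemma exp_small (R : realType) (M c e : R) : 0 < M -> M < 1 -> 0 < e ->
  exists n, M ^+ n * c < e.
Proof.
move=> M0 M1 e0.
have : (fun n => M ^+ n) @ \oo --> (0 : R) by apply: cvg_expr; rewrite gtr0_norm.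
have c1 : 0 < `|c| + 1 by rewrite ltr_wpDl.
move=> /cvgr0Pnorm_lt /(_ (e / (`|c| + 1)) (divr_gt0 e0 c1)) [n _ /(_ n (leqnn n))].
rewrite /= ger0_norm ?exprn_ge0 ?ltW// ltr_pdivlMr// => h; exists n.
have := ler_norm c; have := exprn_ge0 n (ltW M0); nra.
Qed.

(** * Solving u = f + V u *)

(** What the fixed point argument uses of the operator [V_B]: it is causal,
    linear, a contraction, controlled by the seminorms, and restarting it at a
    later time costs a term evolving under [T]. *)
Record causal_contraction (R : realType) (K : scalars R)
    (X : completeNormedModType K) (P : set (X -> R)) (T : R -> X -> X)
    (t0 M : R) (V : (R -> X) -> R -> X) : Prop := {
  cc_gt0 : 0 < M;
  cc_lt1 : M < 1;
  cc_ext : forall (t : R) f g, 0 <= t ->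
    (forall r : R, 0 <= r <= t -> f r = g r) -> ucb P t f -> V f t = V g t;
  cc_linear : forall (t : R) (a : K) f g, 0 <= t <= t0 -> ucb P t f -> ucb P t g ->
    V (fun r => a *: f r + g r) t = a *: V f t + V g t;
  cc_ucb : forall (b : R) f, 0 <= b <= t0 -> ucb P b f -> ucb P b (V f);
  cc_nrm : forall f (t b : R), 0 <= t <= t0 -> ucb P t f -> bdd_by t f b ->
    nrm (V f t) <= M * b;
  cc_sn : forall (e : R) (p : X -> R), 0 < e -> P p -> exists q (k : R),
    [/\ P q, 0 < k & forall f (t a b : R), 0 <= t <= t0 -> ucb P t f ->
      (forall r : R, 0 <= r <= t -> q (f r) <= a) -> bdd_by t f b ->
      p (V f t) <= k * a + e * b];
  cc_cat : forall (s c : R) f, 0 <= s -> 0 <= c -> s + c <= t0 ->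
    ucb P (s + c) f -> V f (s + c) = T c (V f s) + V (fun r => f (s + r)) c
}.

Section contraction.
Variables (R : realType) (K : scalars R) (X : completeNormedModType K).
Variables (P : set (X -> R)) (hX : bicont_space P).
Variables (T : R -> X -> X) (t0 M : R) (V : (R -> X) -> R -> X).
Hypotheses (t0_gt0 : 0 < t0) (hV : causal_contraction P T t0 M V).
Implicit Types (p q : X -> R) (x y z : X) (f g u v : R -> X).

Let M_gt0 := cc_gt0 hV.
Let M_lt1 := cc_lt1 hV.

Lemma ccD (t : R) f g : 0 <= t <= t0 -> ucb P t f -> ucb P t g ->
  V (fun r => f r + g r) t = V f t + V g t.
Proof.
move=> tt fc gc; have := cc_linear hV 1 tt fc gc.
rewrite scale1r => <-; congr V; apply/funext => r.
by rewrite scale1r.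
Qed.

Lemma ccB (t : R) f g : 0 <= t <= t0 -> ucb P t f -> ucb P t g ->
  V (fun r => f r - g r) t = V f t - V g t.
Proof.
move=> tt fc gc; have := cc_linear hV (-1) tt gc fc.
rewrite scaleN1r addrC => <-; congr V; apply/funext => r.
by rewrite scaleN1r addrC.
Qed.

Let M1 : 0 < 1 - M. Proof. by rewrite subr_gt0. Qed.

Lemma cc_bdd (t b : R) f : t <= t0 -> ucb P t f -> bdd_by t f b ->
  bdd_by t (V f) (M * b).
Proof.
move=> tt fc fb r /andP[r0 rt]; apply: (cc_nrm hV).
- by rewrite r0 (le_trans rt).
- exact: ucb_sub fc.
- by move=> s /andP[s0 sr]; apply: fb; rewrite s0 (le_trans sr).
Qed.

(** Iterating [u = f + V u] improves any bound of [u] down to the limit of the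
    geometric series. *)
Lemma fixpoint_bound (t b : R) f u : 0 <= t <= t0 -> ucb P t u ->
  (forall r : R, 0 <= r <= t -> u r = f r + V u r) -> bdd_by t f b ->
  bdd_by t u (b / (1 - M)).
Proof.
move=> /andP[tge0 tt] uc ue fb; have [B uB] := uc.2.
have main n : bdd_by t u (b / (1 - M) + M ^+ n * (B - b / (1 - M))).
  elim: n => [|n IH]; first by rewrite expr0 mul1r subrKC.
  move=> r rt; rewrite ue//; apply: le_trans (nrmD _ _) _.
  apply: le_trans (lerD (fb r rt) (cc_bdd tt uc IH rt)) _.
  rewrite exprS le_eqVlt; apply/orP; left; apply/eqP.
  by field; rewrite gt_eqF.
move=> r rt; apply/ler_addgt0Pr => e e0.
have [n hn] := exp_small (B - b / (1 - M)) M_gt0 M_lt1 e0.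
by apply: le_trans (main n r rt) _; rewrite lerD2l ltW.
Qed.

Lemma fixpoint_unique (t : R) f u v : 0 <= t <= t0 -> ucb P t u -> ucb P t v ->
  (forall r : R, 0 <= r <= t -> u r = f r + V u r) ->
  (forall r : R, 0 <= r <= t -> v r = f r + V v r) ->
  forall r : R, 0 <= r <= t -> u r = v r.
Proof.
move=> tt uc vc ue ve r rt; have /andP[tge0 tt0] := tt.
have := @fixpoint_bound t 0 (fun=> 0) (fun r => u r - v r) tt (ucbB hX uc vc) _ _ r rt.
rewrite mul0r => h; apply/eqP; rewrite -subr_eq0; apply/eqP/nrm0_eq0/eqP.
rewrite eq_le nrm_ge0 andbT; apply: h => [s st|s _]; last by rewrite nrm0.
have /andP[s0 st'] := st.
rewrite ccB ?s0 ?(le_trans st')//; try exact: ucb_sub st' _.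
by rewrite ue// ve//; lincomb.
Qed.

Let iterate f (n : nat) : R -> X := iter n (fun u r => f r + V u r) f.

Let iterateS f n r : iterate f n.+1 r = f r + V (iterate f n) r.
Proof. by []. Qed.

Let iterate_ucb f n : ucb P t0 f -> ucb P t0 (iterate f n).
Proof.
move=> fc; elim: n => [//|n IH]; apply: (ucbD hX) => //.
by apply: (cc_ucb hV) => //; rewrite lexx ltW.
Qed.

Let iterate_bdd f n (b : R) : ucb P t0 f -> bdd_by t0 f b ->
  bdd_by t0 (iterate f n) (b / (1 - M)).
Proof.
move=> fc fb; have b0 : 0 <= b.
  by apply: le_trans (nrm_ge0 (f 0)) (fb 0 _); rewrite lexx ltW.
elim: n => [|n IH] r rt.
  apply: le_trans (fb r rt) _; by rewrite ler_pdivlMr// mulrBr mulr1 gerBl mulr_ge0// ltW.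
rewrite iterateS; apply: le_trans (nrmD _ _) _.
apply: le_trans (lerD (fb r rt) (cc_bdd (lexx _) (iterate_ucb n fc) IH rt)) _.
by rewrite le_eqVlt; apply/orP; left; apply/eqP; field; rewrite gt_eqF.
Qed.

Let iterate_cauchy f n k (b : R) : ucb P t0 f -> bdd_by t0 f b ->
  bdd_by t0 (fun r => iterate f (n + k) r - iterate f n r) (M ^+ n * (b / (1 - M))).
Proof.
move=> fc fb; have b0 : 0 <= b.
  by apply: le_trans (nrm_ge0 (f 0)) (fb 0 _); rewrite lexx ltW.
have B0 : 0 <= b / (1 - M) by rewrite divr_ge0// ltW.
elim: n => [|n IH] r rt; last first.
  have -> : iterate f (n.+1 + k) r - iterate f n.+1 r =
      V (fun r => iterate f (n + k) r - iterate f n r) r.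
    have /andP[r0 rt'] := rt.
    rewrite ccB//; try by apply: ucb_sub rt' _; exact: iterate_ucb.
    by rewrite addSn !iterateS; lincomb.
  rewrite exprS -mulrA; apply: cc_bdd rt => //.
  by apply: (ucbB hX); exact: iterate_ucb.
rewrite expr0 mul1r add0n; case: k => [|k]; first by rewrite subrr nrm0.
have -> : iterate f k.+1 r - iterate f 0 r = V (iterate f k) r.
  by rewrite iterateS /iterate/=; lincomb.
apply: le_trans (cc_bdd (lexx _) (iterate_ucb k fc) (iterate_bdd k fc fb) rt) _.
by rewrite ler_piMl// ltW.
Qed.

(** Picard iteration: the iterates converge uniformly in norm, the limit being
    produced by the completeness of bounded sets for [tau]. *)
Lemma fixpoint_exists f : ucb P t0 f -> exists u, ucb P t0 u /\
  forall r : R, 0 <= r <= t0 -> u r = f r + V u r.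
Proof.
move=> fc; have [b fb] := fc.2; set c := b / (1 - M).
have cau n k r : 0 <= r <= t0 -> nrm (iterate f (n + k) r - iterate f n r) <= M ^+ n * c.
  by move=> rt; exact: (iterate_cauchy n k fc fb).
have lim r : exists l, 0 <= r <= t0 -> tau_seq_lim P (iterate f ^~ r) l.
  have [rt|nrt] := boolP (0 <= r <= t0); last by exists 0.
  have [||l /tau_seq_limP hl] := bs_complete hX (u := iterate f ^~ r);
    last by exists l.
    by exists c => n; exact: (iterate_bdd n fc fb).
  move=> p Pp e e0; have [n hn] := exp_small c M_gt0 M_lt1 (ltac:(lra) : 0 < e / 2).
  exists n => m k nm nk.
  apply: le_lt_trans (sn_triangle hX (iterate f n r) _ _ Pp) _.
  rewrite (snC hX (iterate f n r))//.
  have h1 := le_trans (sn_le_nrm hX _ Pp) (cau n (m - n)%N r rt).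
  have h2 := le_trans (sn_le_nrm hX _ Pp) (cau n (k - n)%N r rt).
  move: h1 h2; rewrite !subnKC//; lra.
have [u hu] := choice lim.
have ulim n r : 0 <= r <= t0 -> nrm (u r - iterate f n r) <= M ^+ n * c.
  move=> rt; apply: (nrm_le_eps hX) => p e Pp e0.
  have [N hN] := hu r rt p e Pp e0.
  have h1 := hN (n + N)%N (leq_addl _ _).
  have h2 := le_trans (sn_le_nrm hX _ Pp) (cau n N r rt).
  apply: le_trans (sn_triangle hX (iterate f (n + N) r) _ _ Pp) _.
  rewrite (snC hX (u r))//; lra.
have uc : ucb P t0 u.
  split; last first.
    exists (c + M ^+ 0 * c) => r rt.
    have := iterate_bdd 0 fc fb rt; have := ulim 0%N r rt.
    by have := nrmD (u r - iterate f 0 r) (iterate f 0 r); rewrite subrK; rewrite -/c; lra.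
  move=> p e Pp e0; have [n hn] := exp_small c M_gt0 M_lt1 (ltac:(lra) : 0 < e / 4).
  have [d d0 hd] := (iterate_ucb n fc).1 p (e / 2) Pp ltac:(lra).
  exists d => // s t st tt dst.
  have h1 := le_trans (sn_le_nrm hX _ Pp) (ulim n s st).
  have h2 := le_trans (sn_le_nrm hX _ Pp) (ulim n t tt).
  have h3 := hd s t st tt dst.
  have -> : u s - u t = (u s - iterate f n s) - (u t - iterate f n t) +
    (iterate f n s - iterate f n t) by lincomb.
  apply: le_lt_trans (snD hX _ _ Pp) _.
  have := snB hX (u s - iterate f n s) (u t - iterate f n t) Pp; lra.
exists u; split=> // r rt; have /andP[r0 rt'] := rt.
apply/eqP; rewrite -subr_eq0; apply/eqP/nrm0_eq0/eqP.
rewrite eq_le nrm_ge0 andbT; apply/ler_addgt0Pr => e e0; rewrite add0r.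
have [n hn] := exp_small c M_gt0 M_lt1 (ltac:(lra) : 0 < e / 2).
have -> : u r - (f r + V u r) = (u r - iterate f n.+1 r) -
    V (fun r => u r - iterate f n r) r.
  rewrite ccB//; try by apply: ucb_sub rt' _ => //; exact: iterate_ucb.
  by rewrite !iterateS; lincomb.
apply: le_trans (nrmB _ _) _.
have h1 := ulim n.+1 r rt.
have h2 := cc_bdd (lexx _) (ucbB hX uc (iterate_ucb n fc)) (ulim n) rt.
move: h1; rewrite exprS -mulrA => h1.
have : M * (M ^+ n * c) <= e / 2.
  have c0 : 0 <= M ^+ n * c by apply: le_trans (nrm_ge0 _) (ulim n r rt).
  by apply: le_trans (ltW hn); rewrite ler_piMl// ltW.
lra.
Qed.

End contraction.

(** * The perturbed semigroup for small times *)

Section local_semigroup.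
Variables (R : realType) (K : scalars R) (X : completeNormedModType K).
Variables (P : set (X -> R)) (hX : bicont_space P).
Variables (T : R -> X -> X) (hT : bicont_semigroup P T).
Variables (t0 M : R) (V : (R -> X) -> R -> X).
Hypotheses (t0_gt0 : 0 < t0) (hV : causal_contraction P T t0 M V).
Implicit Types (p q : X -> R) (x y z : X) (f g u v : R -> X).

Let t0t0 : 0 <= t0 <= t0. Proof. by rewrite lexx ltW. Qed.
Let M_gt0 := cc_gt0 hV.
Let M_lt1 := cc_lt1 hV.
Let M1 : 0 < 1 - M. Proof. by rewrite subr_gt0 (cc_lt1 hV). Qed.

(** The solution of the variation of constants formula. *)
Definition pert (t : R) x : X := xget (fun=> 0) [set u | ucb P t0 u /\
  forall r : R, 0 <= r <= t0 -> u r = T r x + V u r] t.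

Lemma pertP x : ucb P t0 (pert ^~ x) /\
  forall r : R, 0 <= r <= t0 -> pert r x = T r x + V (pert ^~ x) r.
Proof.
have [u hu] := fixpoint_exists hX t0_gt0 hV (sg_orbit hX hT t0 x).
by rewrite /pert; case: xgetP => [v _ //|/(_ u)].
Qed.

Lemma pert_ucb x : ucb P t0 (pert ^~ x). Proof. exact: (pertP x).1. Qed.

Lemma pert_unique (t : R) x u : t <= t0 -> ucb P t u ->
  (forall r : R, 0 <= r <= t -> u r = T r x + V u r) ->
  forall r : R, 0 <= r <= t -> u r = pert r x.
Proof.
move=> tt uc ue r rt; have /andP[r0 rt'] := rt.
have tt0 : 0 <= t <= t0 by rewrite tt (le_trans r0).
apply: (fixpoint_unique hX hV (v := pert ^~ x) tt0 uc _ ue _ rt).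
  by apply: ucb_sub (pert_ucb x).
by move=> s /andP[s0 st]; rewrite (pertP x).2// s0 (le_trans st).
Qed.

Lemma pert0 x : pert 0 x = x.
Proof.
rewrite (pertP x).2 ?lexx ?ltW// (sg_zero hT) -[RHS]addr0; congr (_ + _).
have z0 : 0 <= (0 : R) by [].
have fc : ucb P 0 (pert ^~ x) by apply: ucb_sub (pert_ucb x); exact: ltW.
(* at time 0 the restart formula reads V f 0 = V f 0 + V f 0 *)
have := cc_cat hV z0 z0 (c := 0) (f := pert ^~ x).
rewrite addr0 (sg_zero hT) => /(_ (ltW t0_gt0) fc).
rewrite (cc_ext hV (f := fun r => pert (0 + r) x) (g := pert ^~ x))//.
- by move=> h; apply: (addrI (V (pert ^~ x) 0)); rewrite addr0 -h.
- by move=> r _; rewrite add0r.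
- by apply: ucb_ext fc => r _; rewrite add0r.
Qed.

Lemma pert_linear (t : R) : 0 <= t <= t0 -> linear (pert t).
Proof.
move=> tt a x y; apply/esym.
apply: (pert_unique (u := fun r => a *: pert r x + pert r y) (lexx t0) _ _ tt).
  by apply: (ucbZD hX); exact: pert_ucb.
move=> r rt; have /andP[r0 rt'] := rt.
rewrite (cc_linear hV)//; try exact: ucb_sub rt' (pert_ucb _).
rewrite (sg_linear hT r0) [pert r x](pertP x).2// [pert r y](pertP y).2//.
by lincomb.
Qed.

(** Restarted at time [s], the solution solves the equation with initial value
    [pert s x]; uniqueness identifies it. *)
Lemma pert_add (s t : R) x : 0 <= s -> 0 <= t -> s + t <= t0 ->
  pert (s + t) x = pert t (pert s x).
Proof.
move=> s0 tge0 st; have tt : t <= t0 by lra.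
have uc : ucb P t (fun r => pert (s + r) x) by apply: (ucb_shift s0 _ (pert_ucb x)).
apply: (pert_unique (u := fun r => pert (s + r) x) tt uc) => [r /andP[r0 rt]|]; last first.
  by rewrite tge0 lexx.
have sr : 0 <= s + r <= t0 by apply/andP; split; lra.
have ss : 0 <= s <= t0 by apply/andP; split; lra.
rewrite (pertP x).2// (cc_cat hV)//; last 2 first.
- by case/andP : sr.
- by apply: ucb_sub (pert_ucb x); case/andP : sr.
rewrite (addrC s r) (sg_add hT)// addrA -(linD (sg_linear hT r0)).
by rewrite -(pertP x).2.
Qed.

Lemma pert_bounded : exists2 c : R, 0 <= c &
  forall (t : R) x, 0 <= t <= t0 -> nrm (pert t x) <= c * nrm x.
Proof.
have [c c0 hc] := sg_locally_bounded hT t0.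
exists (c / (1 - M)) => [|t x tt]; first by rewrite divr_ge0// ltW.
rewrite mulrAC; apply: (fixpoint_bound hV t0t0 (pert_ucb x) (pertP x).2) tt.
by move=> r; exact: hc.
Qed.

(** Bi-equicontinuity: the orbits of a null sequence split into finitely many
    terms of the Neumann series, uniformly null, and a remainder small in norm. *)
Lemma pert_split (u : nat -> X) : seq_bounded u -> tau_seq_lim P u 0 ->
  exists c : R, forall k : nat, exists (v w : nat -> R -> X) (d : R),
  [/\ forall n, ucb P t0 (v n) /\ ucb P t0 (w n),
      forall n (t : R), 0 <= t <= t0 -> pert t (u n) = v n t + w n t,
      forall n, bdd_by t0 (v n) d /\ bdd_by t0 (w n) (M ^+ k * c) &
      forall p (e : R), P p -> 0 < e -> exists N, forall n, (N <= n)%N ->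
        forall t : R, 0 <= t <= t0 -> p (v n t) <= e].
Proof.
move=> [C hC] u0; have [cT cT0 hT'] := sg_locally_bounded hT t0.
have [cS cS0 hS] := pert_bounded.
have C0 : 0 <= C by apply: le_trans (nrm_ge0 _) (hC 0%N).
have z0 : 0 <= (0 : R) <= t0 by rewrite lexx ltW.
exists (cS * C); elim=> [|k [v [w [d [vw_ucb vw_eq vw_bdd v_null]]]]].
  exists (fun _ _ => 0), (fun n => pert ^~ (u n)), 0; split.
  - by move=> n; split; [exact: ucb_cst|exact: pert_ucb].
  - by move=> n t _; rewrite add0r.
  - move=> n; split=> t tt; first by rewrite nrm0.
    rewrite expr0 mul1r; apply: le_trans (hS t _ tt) _.
    by rewrite ler_wpM2l.
  - by move=> p e Pp e0; exists 0%N => n _ t _; rewrite (sn0 hX)// ltW.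
exists (fun n r => T r (u n) + V (v n) r), (fun n => V (w n)), (cT * C + M * d).
split.
- move=> n; have [vn wn] := vw_ucb n; split; last exact: (cc_ucb hV).
  by apply: (ucbD hX); [exact: sg_orbit|exact: (cc_ucb hV)].
- move=> n t tt; have /andP[tge0 tt'] := tt; have [vn wn] := vw_ucb n.
  rewrite (pertP (u n)).2// -addrA; congr (_ + _).
  rewrite -(ccD hV tt); try exact: ucb_sub tt' _.
  apply: (cc_ext hV) => //; last exact: ucb_sub tt' (pert_ucb _).
  by move=> r /andP[r0 rt]; rewrite vw_eq// r0 (le_trans rt).
- move=> n; have [vn wn] := vw_ucb n; have [vb wb] := vw_bdd n; split=> t tt.
    apply: le_trans (nrmD _ _) _; apply: lerD.
      by apply: le_trans (hT' t _ tt) _; rewrite ler_wpM2l.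
    exact: (cc_bdd hV (lexx t0) vn vb tt).
  rewrite exprS -mulrA; exact: (cc_bdd hV (lexx t0) wn wb tt).
move=> p e Pp e0.
have d0 : 0 <= d by have [vb _] := vw_bdd 0%N; apply: le_trans (nrm_ge0 _) (vb 0 z0).
have e4 : 0 < e / 4 / (d + 1) by rewrite !divr_gt0//; lra.
have [q [l [Pq l0 hq]]] := cc_sn hV e4 Pp.
have [N1 hN1] := v_null q (e / 4 / l) Pq ltac:(by rewrite !divr_gt0).
have [N2 hN2] := (bi_equicontinuousP P _).1 (sg_equi0 hT (ltW t0_gt0)) u
  (ex_intro _ C hC) u0 p (e / 2) Pp ltac:(lra).
exists (maxn N1 N2) => n; rewrite geq_max => /andP[n1 n2] t tt.
have /andP[tge0 tt'] := tt.
have h2 : p (T t (u n)) < e / 2.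
  by apply: (hN2 n n2); exists t => //=; rewrite in_itv.
have [vn wn] := vw_ucb n; have [vb wb] := vw_bdd n.
have h1 : p (V (v n) t) <= l * (e / 4 / l) + e / 4 / (d + 1) * d.
  apply: hq => //; first exact: ucb_sub vn.
    by move=> r /andP[r0 rt]; apply: hN1 => //; rewrite r0 (le_trans rt).
  by move=> r /andP[r0 rt]; apply: vb; rewrite r0 (le_trans rt).
apply: le_trans (snD hX _ _ Pp) _.
have e1 : l * (e / 4 / l) = e / 4 by field; rewrite gt_eqF.
have e2 : e / 4 / (d + 1) * d <= e / 4.
  by rewrite mulrAC -mulrA ler_piMr//; [lra|rewrite ler_pdivrMr//; lra].
lra.
Qed.

Lemma pert_equi : bi_equicontinuous P [set pert t | t in `[0, t0]].
Proof.
apply/bi_equicontinuousP => u ub u0 p e Pp e0.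
have [c hc] := pert_split ub u0.
have [k hk] := exp_small c M_gt0 M_lt1 (ltac:(lra) : 0 < e / 2).
have [v [w [d [_ vw_eq vw_bdd v_null]]]] := hc k.
have [N hN] := v_null p (e / 2) Pp ltac:(lra).
exists N => n Nn _ [t /= tt <-]; move: tt; rewrite in_itv/= => tt.
rewrite vw_eq//; apply: le_lt_trans (snD hX _ _ Pp) _.
have := hN n Nn t tt; have := (vw_bdd n).2 t tt.
have := sn_le_nrm hX (w n t) Pp; lra.
Qed.

End local_semigroup.

(** * Extending a semigroup from a bounded time interval *)

Section extension.
Variables (R : realType) (K : scalars R) (X : completeNormedModType K).
Variables (P : set (X -> R)) (hX : bicont_space P).
Variables (t0 : R) (S : R -> X -> X).
Hypothesis t0_gt0 : 0 < t0.
Implicit Types (p q : X -> R) (x y z : X) (r s t : R).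

(** The inner family turns a null sequence into a null family indexed by pairs
    [(n, Q)], to which bi-equicontinuity of the outer family applies. *)
Lemma bi_equi_comp (Bs Cs : set (X -> X)) (c : R) :
  bi_equicontinuous P Bs -> bi_equicontinuous P Cs ->
  (forall Q x, Cs Q -> nrm (Q x) <= c * nrm x) ->
  bi_equicontinuous P [set Q | exists B D, [/\ Bs B, Cs D & Q = B \o D]].
Proof.
move=> hB /bi_equicontinuousP hC Cc; apply/bi_equicontinuousP => u ub u0 p e Pp e0.
have [k uk] := ub; have k0 : 0 <= k by apply: le_trans (nrm_ge0 _) (uk 0%N).
have [||d d0 hd] := @bi_equi_uniform _ _ _ _ _ (nat * (X -> X))%type
  (fun i => Cs i.2) (fun i => i.1.+1%:R^-1) (fun i => i.2 (u i.1)) (`|c| * k)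
  hB _ _ p e Pp e0.
- move=> [n Q] /= CQ; apply: le_trans (Cc Q _ CQ) _.
  apply: le_trans (ler_wpM2r (nrm_ge0 _) (ler_norm c)) _.
  by rewrite ler_wpM2l.
- move=> q e' Pq e'0; have [N hN] := hC u ub u0 q e' Pq e'0.
  exists N.+1%:R^-1 => // -[n Q] /= CQ; rewrite ltf_pV2 ?posrE// ltr_nat ltnS => Nn.
  exact: hN (ltnW Nn) Q CQ.
exists (Num.truncn d^-1) => n Nn _ [B [D [BB CD ->]]] /=.
apply: (hd (n, D) CD _ B BB) => /=.
rewrite invf_plt ?posrE//; apply: lt_le_trans (truncnS_gt _) _.
by rewrite ler_nat.
Qed.

Hypothesis S_linear : forall t, 0 <= t <= t0 -> linear (S t).
Hypothesis S_bounded : exists2 c : R, 0 <= c &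
  forall t x, 0 <= t <= t0 -> nrm (S t x) <= c * nrm x.
Hypothesis S_ucb : forall x, ucb P t0 (S ^~ x).
Hypothesis S_equi : bi_equicontinuous P [set S t | t in `[0, t0]].
Hypothesis S_zero : forall x, S 0 x = x.
Hypothesis S_add : forall s t x, 0 <= s -> 0 <= t -> s + t <= t0 ->
  S (s + t) x = S t (S s x).

Definition nsteps t : nat := (Num.truncn (t / t0)).+1.

(** Time [t] is reached in [nsteps t] equal steps; any larger number of steps
    gives the same operator (lemma [sg_extE]). *)
Definition sg_ext t x : X := iter (nsteps t) (S (t / (nsteps t)%:R)) x.

Let step_itv t n : 0 <= t -> (0 < n)%N -> t <= n%:R * t0 -> 0 <= t / n%:R <= t0.
Proof. by move=> t1 n0 tn; rewrite divr_ge0//= ler_pdivrMr ?ltr0n// mulrC. Qed.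

Lemma nsteps_le t : t <= (nsteps t)%:R * t0.
Proof. by rewrite -ler_pdivrMr// ltW// truncnS_gt. Qed.

Lemma iter_step n r x : 0 <= r -> n%:R * r <= t0 -> iter n (S r) x = S (n%:R * r) x.
Proof.
move=> r0; elim: n => [|n IH] nr; first by rewrite mul0r S_zero.
have e1 : n.+1%:R * r = n%:R * r + r by rewrite -natr1 mulrDl mul1r.
have n0 : 0 <= n%:R * r by rewrite mulr_ge0.
rewrite iterS IH; last by lra.
by rewrite e1 S_add//; lra.
Qed.

Lemma iter_refine t n m x : 0 <= t -> (0 < n)%N -> (0 < m)%N -> t <= n%:R * t0 ->
  iter (n * m) (S (t / (n * m)%:R)) x = iter n (S (t / n%:R)) x.
Proof.
move=> t1 n0 m0 tn; rewrite iterM; apply: eq_iter => y.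
have n0' : n%:R != 0 :> R by rewrite pnatr_eq0 -lt0n.
have m0' : m%:R != 0 :> R by rewrite pnatr_eq0 -lt0n.
have e1 : m%:R * (t / (n * m)%:R) = t / n%:R.
  by rewrite natrM; field; rewrite n0' m0'.
rewrite iter_step ?e1 ?divr_ge0//.
by have /andP[] := step_itv t1 n0 tn.
Qed.

Lemma sg_extE t n x : 0 <= t -> (0 < n)%N -> t <= n%:R * t0 ->
  sg_ext t x = iter n (S (t / n%:R)) x.
Proof.
move=> t1 n0 tn; rewrite /sg_ext -(iter_refine (n := n) (m := nsteps t))//.
by rewrite -(iter_refine (n := nsteps t) (m := n))// ?nsteps_le// mulnC.
Qed.

Lemma sg_ext_local t x : 0 <= t <= t0 -> sg_ext t x = S t x.
Proof. by move=> /andP[t1 tt]; rewrite (sg_extE (n := 1%N))//= ?divr1 ?mul1r. Qed.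

Lemma step_comm s t x : 0 <= s -> 0 <= t -> s + t <= t0 -> S t (S s x) = S s (S t x).
Proof. by move=> s0 t1 st; rewrite -!S_add// addrC. Qed.

Lemma iter_comp (f g : X -> X) n x : (forall y, f (g y) = g (f y)) ->
  iter n (f \o g) x = iter n f (iter n g x).
Proof.
move=> fg; have gfn k y : g (iter k f y) = iter k f (g y).
  by elim: k => //= k <-.
by elim: n => //= n ->; rewrite gfn.
Qed.

Let common_steps s t : 0 <= s -> 0 <= t -> exists n, [/\ (0 < n)%N,
  s + t <= n%:R * t0, s <= n%:R * t0 & t <= n%:R * t0].
Proof.
move=> s0 t1; exists (nsteps (s + t)); split=> //; first exact: nsteps_le.
all: by have := nsteps_le (s + t); lra.
Qed.

(** With a number of steps common to [s], [t] and [s + t] the factors commute and can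
    be sorted. *)
Lemma sg_ext_add s t x : 0 <= s -> 0 <= t -> sg_ext (s + t) x = sg_ext s (sg_ext t x).
Proof.
move=> s0 t1; have [n [n0 stn sn tn]] := common_steps s0 t1.
rewrite (sg_extE _ (addr_ge0 s0 t1) n0 stn) (sg_extE _ s0 n0 sn) (sg_extE _ t1 n0 tn).
have /andP[a0 a1] := step_itv s0 n0 sn; have /andP[b0 b1] := step_itv t1 n0 tn.
have /andP[_] := step_itv (addr_ge0 s0 t1) n0 stn; rewrite mulrDl => ab.
rewrite -iter_comp; last by move=> y; apply: step_comm => //; rewrite addrC.
by apply: eq_iter => y; rewrite /= addrC S_add// addrC.
Qed.

Lemma sg_ext_zero x : sg_ext 0 x = x.
Proof. by rewrite sg_ext_local ?S_zero// lexx ltW. Qed.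

Let iter_linear n r : 0 <= r <= t0 -> linear (iter n (S r)).
Proof. by move=> rt a x y; elim: n => //= n ->; rewrite S_linear. Qed.

Let iter_bounded c n r x : 0 <= c ->
  (forall t x, 0 <= t <= t0 -> nrm (S t x) <= c * nrm x) -> 0 <= r <= t0 ->
  nrm (iter n (S r) x) <= c ^+ n * nrm x.
Proof.
move=> c0 hc rt; elim: n => /= [|n IH]; first by rewrite expr0 mul1r.
by apply: le_trans (hc _ _ rt) _; rewrite exprS -mulrA ler_wpM2l.
Qed.

Lemma sg_ext_linear t : 0 <= t -> linear (sg_ext t).
Proof. by move=> t1; apply/iter_linear/step_itv => //; exact: nsteps_le. Qed.

Lemma sg_ext_growth : exists M w : R, 1 <= M /\
  forall t, 0 <= t -> (opnorm (sg_ext t) <= (M * expR (w * t))%:E)%E.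
Proof.
have [c c0 hc] := S_bounded; have c1 : 0 < c + 1 by lra.
exists (c + 1), (ln (c + 1) / t0); split; first lra.
have hc' t x : 0 <= t <= t0 -> nrm (S t x) <= (c + 1) * nrm x.
  by move=> tt; apply: le_trans (hc t x tt) _; rewrite ler_wpM2r ?nrm_ge0//; lra.
move=> t t1; apply/(opnorm_leP (sg_ext_linear t1)) => [|x].
  by rewrite mulr_ge0 ?expR_ge0// ltW.
apply: le_trans (iter_bounded _ _ (ltW c1) hc' (step_itv t1 _ (nsteps_le t))) _ => //.
rewrite ler_wpM2r ?nrm_ge0// exprS ler_wpM2l ?(ltW c1)//.
rewrite -[X in X ^+ _ <= _](lnK c1) -expRM_natl ler_expR.
have -> : ln (c + 1) / t0 * t = t / t0 * ln (c + 1) by rewrite mulrC mulrCA mulrC.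
rewrite ler_wpM2r ?ln_ge0//; first lra.
by rewrite truncn_le ?divr_ge0// ltW.
Qed.

Let iter_equi n : bi_equicontinuous P [set iter n (S r) | r in `[0, t0]].
Proof.
have [c c0 hc] := S_bounded; elim: n => [|n IH].
  apply/bi_equicontinuousP => u _ u0 p e Pp e0.
  have [N hN] := u0 p e Pp e0; exists N => n Nn _ [r _ <-] /=.
  by have := hN n Nn; rewrite subr0.
apply: bi_equi_sub (bi_equi_comp (c := c ^+ n) S_equi IH _) => [_ [r rt <-]|].
  by exists (S r), (iter n (S r)); split=> //; exists r.
by move=> _ x [r /= rt <-]; apply: iter_bounded => //; move: rt; rewrite in_itv.
Qed.

Let cover s : 0 <= s -> exists n, (0 < n)%N /\ s <= n%:R * t0.
Proof. by move=> s0; exists (nsteps s); split=> //; exact: nsteps_le. Qed.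

Lemma sg_ext_equi s : 0 < s -> bi_equicontinuous P [set sg_ext t | t in `[0, s]].
Proof.
move=> s0; have [n [n0 sn]] := cover (ltW s0).
apply: bi_equi_sub (iter_equi n) => _ [t /= + <-]; rewrite in_itv/= => /andP[t1 ts].
have tn : t <= n%:R * t0 by exact: le_trans sn.
exists (t / n%:R); first by rewrite /= in_itv/= step_itv.
by apply/funext => x; rewrite (sg_extE x t1 n0 tn).
Qed.

Lemma sg_ext_ucb (b : R) x : ucb P b (sg_ext ^~ x).
Proof.
have [b0|b0] := ltP b 0.
  by split; [move=> p e Pp e0; exists 1 => // s t|exists 0 => t] => /andP[? ?]; lra.
have [n [n0 bn]] := cover b0; have [c c0 hc] := S_bounded.
have st t : 0 <= t <= b -> 0 <= t / n%:R <= t0.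
  by move=> /andP[t1 tb]; apply: step_itv => //; exact: le_trans bn.
suff main k : ucb P b (fun t => iter k (S (t / n%:R)) x).
  apply: ucb_ext (main n) => t /andP[t1 tb].
  by rewrite (sg_extE x t1 n0)// (le_trans tb).
elim: k => /= [|k IH]; first exact: ucb_cst.
apply: (@ucb_apply _ _ _ _ hX (fun t => S (t / n%:R)) b c) IH.
- apply: bi_equi_sub S_equi => _ [t /= + <-]; rewrite in_itv/= => tb.
  by exists (t / n%:R) => //; rewrite /= in_itv/= st.
- by move=> t /st; exact: S_linear.
- by move=> t y /st; exact: hc.
- move=> y; have [] // := @ucb_comp _ _ _ P t0 b _ (fun t => t / n%:R) st _ (S_ucb y).
  move=> s t _ _; rewrite -mulrBl normrM (@ger0_norm _ n%:R^-1)// ler_piMr//.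
  by rewrite invf_le1 ?ltr0n// ler1n.
Qed.

Lemma bicont_semigroup_ext : bicont_semigroup P sg_ext.
Proof.
have [c c0 hc] := S_bounded; split.
- move=> t t1; apply/bounded_linearP; split; first exact: sg_ext_linear.
  exists (c ^+ nsteps t); first exact: exprn_ge0.
  by move=> x; apply: iter_bounded => //; apply: step_itv => //; exact: nsteps_le.
- exact: sg_ext_add.
- exact: sg_ext_zero.
- move=> x t /=; rewrite in_itv/= andbT => t1; apply/tau_cvgP => p e Pp e0.
  have [d d0 hd] := (sg_ext_ucb (t + 1) x).1 p e Pp e0.
  rewrite near_withinE; apply/nbhs_ballP; exists (Num.min d 1) => /=.
    by rewrite lt_min d0 ltr01.
  move=> s; rewrite /ball/= lt_min => /andP[sd s1]; rewrite in_itv/= andbT => s0.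
  apply: hd; last by rewrite distrC.
    by move: s1; rewrite ltr_norml => /andP[? ?]; apply/andP; split; lra.
  by apply/andP; split; lra.
- exact: sg_ext_growth.
- exact: sg_ext_equi.
Qed.

End extension.

(** * The generator of the perturbed semigroup *)

Section generator.
Variables (R : realType) (K : scalars R) (X : completeNormedModType K).
Variables (P : set (X -> R)) (hX : bicont_space P).
Implicit Types (p q : X -> R) (x y z : X) (f g u v w : R -> X).
Variables (t0 : R) (t0_gt0 : 0 < t0).

(** The remainders of first order expansions along orbits: negligible for each
    seminorm and O(r) in norm, which are the two halves of the definition of the
    generator. *)
Definition tau_little_o f : Prop :=
  (exists c : R, forall r : R, 0 <= r <= t0 -> nrm (f r) <= c * r) /\
  forall p (e : R), P p -> 0 < e -> exists2 d : R, 0 < d &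
    forall r : R, 0 <= r <= t0 -> r < d -> p (f r) <= e * r.

Lemma tau_little_oB f g : tau_little_o f -> tau_little_o g ->
  tau_little_o (fun r => f r - g r).
Proof.
move=> [[c fc] fs] [[c' gc] gs]; split.
  exists (c + c') => r rt; apply: le_trans (nrmB _ _) _.
  by rewrite mulrDl lerD ?fc ?gc.
move=> p e Pp e0; have [d d0 hd] := fs p (e / 2) Pp ltac:(lra).
have [d' d'0 hd'] := gs p (e / 2) Pp ltac:(lra).
exists (Num.min d d'); first by rewrite lt_min d0.
move=> r rt; rewrite lt_min => /andP[rd rd'].
apply: le_trans (snB hX _ _ Pp) _.
have := hd r rt rd; have := hd' r rt rd'; lra.
Qed.

Lemma tau_little_o_ext f g : (forall r : R, 0 <= r <= t0 -> f r = g r) ->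
  tau_little_o f -> tau_little_o g.
Proof.
move=> fg [[c fc] fs]; split; first by exists c => r rt; rewrite -fg// fc.
move=> p e Pp e0; have [d d0 hd] := fs p e Pp e0; exists d => // r rt rd.
by rewrite -fg// hd.
Qed.

Lemma tau_little_oD f g : tau_little_o f -> tau_little_o g ->
  tau_little_o (fun r => f r + g r).
Proof.
move=> fo go.
apply: tau_little_o_ext (tau_little_oB fo (tau_little_oB (tau_little_oB go go) go)).
by move=> r _; lincomb.
Qed.

Lemma generator_expansion T x y : bicont_semigroup P T ->
  generator P T x y <-> tau_little_o (fun r => T r x - x - ofR K r *: y).
Proof.
move=> hT.
have quo h : 0 < h -> T h x - x - ofR K h *: y =
    ofR K h *: (ofR K h^-1 *: (T h x - x) - y).
  move=> h0; rewrite scalerBr scalerA -rmorphM mulfV ?gt_eqF//.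
  by rewrite rmorph1 scale1r.
split=> [/generatorP[// hl [c hc]]|[[c hc] hl]].
  have [k k0 hk] := sg_locally_bounded hT t0.
  split.
    exists (`|c| + (k * nrm x + nrm x) + nrm y) => r /andP[r0 rt].
    apply: le_trans (nrmB _ _) _; rewrite nrmZ ger0_norm// mulrDl.
    rewrite [r * nrm y]mulrC lerD2r.
    have [->|rn0] := eqVneq r 0; first by rewrite (sg_zero hT) subrr nrm0 mulr0.
    have rp : 0 < r by rewrite lt_def rn0.
    have B0 : 0 <= k * nrm x + nrm x by rewrite addr_ge0 ?mulr_ge0 ?nrm_ge0.
    have [r1|r1] := leP r 1.
      apply: le_trans (hc r rp r1) _; rewrite ler_wpM2r//.
      by apply: le_trans (ler_norm c) _; rewrite lerDl.
    apply: le_trans (nrmB _ _) _.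
    apply: le_trans (_ : (k * nrm x + nrm x) * r <= _); last first.
      by rewrite ler_wpM2r// lerDr.
    apply: le_trans (_ : k * nrm x + nrm x <= _); last by rewrite ler_peMr// ltW.
    by rewrite lerD2r hk// r0.
  move=> p e Pp e0; have [d d0 hd] := hl p e Pp e0; exists d => // r /andP[r0 rt] rd.
  have [->|rn0] := eqVneq r 0.
    by rewrite (sg_zero hT) subrr rmorph0 scale0r subrr (sn0 hX)// mulr0.
  have rp : 0 < r by rewrite lt_def rn0.
  by rewrite quo// (snZ hX)// gtr0_norm// mulrC ler_wpM2r// ltW// hd.
apply: (generator_local hT t0_gt0).
  move=> p e Pp e0; have [d d0 hd] := hl p (e / 2) Pp ltac:(lra).
  exists (Num.min d t0) => [|h h0]; first by rewrite lt_min d0.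
  rewrite lt_min => /andP[h1 h2].
  have := hd h ltac:(apply/andP; split; lra) h1.
  rewrite quo// (snZ hX)// gtr0_norm// mulrC ler_pM2r//; lra.
exists (c + nrm y) => h h0 h1; rewrite mulrDl.
have := hc h ltac:(apply/andP; split; lra) => h2.
rewrite -(subrK (ofR K h *: y) (T h x - x)).
apply: le_trans (nrmD _ _) _; apply: lerD => //.
by rewrite nrmZ gtr0_norm// mulrC.
Qed.

Variables (T : R -> X -> X) (hT : bicont_semigroup P T).
Variables (M : R) (V : (R -> X) -> R -> X).
Hypothesis hV : causal_contraction P T t0 M V.

Let M_gt0 := cc_gt0 hV.
Let M_lt1 := cc_lt1 hV.
Let M1 : 0 < 1 - M. Proof. by rewrite subr_gt0 (cc_lt1 hV). Qed.

(** The seminorm bound on [0, r] involves only values of [f] of order [r]. *)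
Lemma cc_little_o f : ucb P t0 f -> tau_little_o f -> tau_little_o (V f).
Proof.
move=> fc [[c hc] fs].
have fr r : 0 <= r <= t0 -> bdd_by r f (`|c| * r).
  move=> /andP[r0 rt] s /andP[s0 sr].
  apply: le_trans (hc s _) _; first by rewrite s0 (le_trans sr).
  apply: le_trans (ler_wpM2r s0 (ler_norm c)) _.
  by rewrite ler_wpM2l.
have frc r : 0 <= r <= t0 -> ucb P r f.
  by move=> /andP[_ rt]; apply: ucb_sub fc.
split.
  exists (M * `|c|) => r rt; rewrite -mulrA.
  by apply: (cc_nrm hV) => //; [exact: frc|exact: fr].
move=> p e Pp e0; have c1 : 0 < `|c| + 1 by rewrite ltr_wpDl.
have e4 : 0 < e / 2 / (`|c| + 1) by rewrite !divr_gt0.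
have [q [k [Pq k0 hq]]] := cc_sn hV e4 Pp.
have [d d0 hd] := fs q (e / 2 / k) Pq ltac:(by rewrite !divr_gt0).
exists d => // r rt rd; have /andP[r0 rt'] := rt.
apply: le_trans (hq f r (e / 2 / k * r) (`|c| * r) rt (frc r rt) _ (fr r rt)) _.
  move=> s /andP[s0 sr]; apply: le_trans (hd s _ _) _.
  - by rewrite s0 (le_trans sr).
  - exact: le_lt_trans rd.
  - by rewrite ler_wpM2l// !divr_ge0// ltW.
have -> : k * (e / 2 / k * r) = e / 2 * r by field; rewrite gt_eqF.
have : e / 2 / (`|c| + 1) * (`|c| * r) <= e / 2 * r.
  rewrite mulrA ler_wpM2r// mulrAC -mulrA ler_piMr//; first lra.
  by rewrite ler_pdivrMr//; lra.
lra.
Qed.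

(** Neumann series once more: the remainder is small in norm relative to [r]. *)
Lemma fixpoint_little_o g w : ucb P t0 g -> ucb P t0 w ->
  (forall r : R, 0 <= r <= t0 -> w r = g r + V w r) ->
  tau_little_o g -> tau_little_o w.
Proof.
move=> gc wc we go; have [[c hc] gs] := go.
have t00 : 0 <= t0 <= t0 by rewrite lexx ltW.
have wb r : 0 <= r <= t0 -> nrm (w r) <= (`|c| / (1 - M)) * r.
  move=> rt; have /andP[r0 rt'] := rt; rewrite mulrAC.
  apply: (fixpoint_bound hV rt (ucb_sub rt' wc) (f := g)); last by rewrite r0 lexx.
    by move=> s /andP[s0 sr]; rewrite we// s0 (le_trans sr).
  move=> s /andP[s0 sr]; apply: le_trans (hc s _) _; first by rewrite s0 (le_trans sr).
  apply: le_trans (ler_wpM2r s0 (ler_norm c)) _.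
  by rewrite ler_wpM2l.
set k := `|c| / (1 - M) in wb.
have k0 : 0 <= k by rewrite divr_ge0// ltW.
clearbody k.
have split_w n : exists a b, [/\ ucb P t0 a, ucb P t0 b, tau_little_o a,
    forall r : R, 0 <= r <= t0 -> w r = a r + b r &
    forall r : R, 0 <= r <= t0 -> nrm (b r) <= M ^+ n * k * r].
  elim: n => [|n [a [b [ac bc ao ab hb]]]].
    exists (fun=> 0), w; split=> //; first exact: ucb_cst.
    - split; first by exists 0 => r _; rewrite nrm0 mul0r.
      move=> p e Pp e0; exists 1 => // r /andP[r0 _] _.
      by rewrite (sn0 hX)// mulr_ge0// ltW.
    - by move=> r _; rewrite add0r.
    - by move=> r rt; rewrite expr0 mul1r wb.
  exists (fun r => g r + V a r), (V b); split.
  - by apply: (ucbD hX) => //; exact: (cc_ucb hV).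
  - exact: (cc_ucb hV).
  - by apply: tau_little_oD => //; exact: cc_little_o.
  - move=> r rt; have /andP[r0 rt'] := rt; rewrite we// -addrA; congr (_ + _).
    rewrite -(ccD hV rt); try exact: ucb_sub rt' _.
    apply: (cc_ext hV) => //; last exact: ucb_sub rt' _.
    by move=> s /andP[s0 sr]; rewrite ab// s0 (le_trans sr).
  - move=> r rt; have /andP[r0 rt'] := rt; rewrite exprS -!mulrA.
    apply: (cc_nrm hV) => //; first exact: ucb_sub rt' _.
    move=> s /andP[s0 sr]; apply: le_trans (hb s _) _.
      by rewrite s0 (le_trans sr).
        by rewrite -mulrA ler_wpM2l ?exprn_ge0 ?(ltW M_gt0)// ler_wpM2l.
split; first by exists k.
move=> p e Pp e0; have [n hn] := exp_small k M_gt0 M_lt1 (ltac:(lra) : 0 < e / 2).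
have [a [b [_ _ [_ ao] ab hb]]] := split_w n.
have [d d0 hd] := ao p (e / 2) Pp ltac:(lra).
exists d => // r rt rd; rewrite ab//; apply: le_trans (snD hX _ _ Pp) _.
have h1 := hd r rt rd; have h2 := le_trans (sn_le_nrm hX _ Pp) (hb r rt).
have /andP[r0 _] := rt; have := ler_wpM2r r0 (ltW hn); lra.
Qed.

Variables (J C : X -> X) (lJ : linear J).
Hypothesis hgen : forall x z, generator P T x z <-> x = J z.
Hypothesis V_cst : forall (t : R) x, 0 <= t -> V (fun=> x) t = T t (C x) - C x.
Hypothesis V_ramp : forall (t : R) x, 0 <= t ->
  V (fun r => ofR K r *: x) t = J (T t (C x) - C x) - ofR K t *: C x.

Lemma ucb_ramp x : ucb P t0 (fun r => ofR K r *: x).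
Proof.
apply: (@ucb_scale _ _ _ _ hX t0 1 t0 (fun=> x)); rewrite ?ltW//.
- by move=> s t _ _; rewrite mul1r.
- by move=> s /andP[s0 st]; rewrite ger0_norm.
- exact: ucb_cst.
Qed.

(** By [V_ramp] this is the expansion of the orbit of [J (C y)], whose derivative at 0
    is [C y]. *)
Lemma V_ramp_little_o y : tau_little_o (V (fun r => ofR K r *: y)).
Proof.
have h : generator P T (J (C y)) (C y) by apply/hgen.
apply: tau_little_o_ext ((generator_expansion _ _ hT).1 h) => r /andP[r0 _].
by rewrite V_ramp// (linB lJ) (sg_inv_comm hT hgen).
Qed.

Let S := pert P T t0 V.

Lemma pert_increment x (r : R) : 0 <= r <= t0 ->
  S r x - x = T r (x + C x) - (x + C x) + V (fun s => S s x - x) r.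
Proof.
move=> rt; have /andP[r0 rt'] := rt.
have uc : ucb P r (S ^~ x) by apply: ucb_sub rt' _; exact: (pert_ucb hX hT t0_gt0 hV).
rewrite (ccB hV rt uc (ucb_cst hX r x)) V_cst//.
rewrite {1}/S (pertP hX hT t0_gt0 hV x).2// (linD (sg_linear hT r0)) -/S.
by lincomb.
Qed.

(** Put [w r = S r x - x - r y] and [e r = T r (x + C x) - (x + C x) - r y]. By
    [pert_increment], [w = e + V (r y) + V w], where [V (r y)] is negligible. Since
    [V] preserves negligible functions and [1 - V] can be inverted on them, [w] is
    negligible if and only if [e] is. *)
Lemma generator_pert x y :
  generator P (sg_ext t0 S) x y <-> x + C x = J y.
Proof.
have hS : bicont_semigroup P (sg_ext t0 S).
  apply: (bicont_semigroup_ext hX t0_gt0).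
  - exact: (pert_linear hX hT t0_gt0 hV).
  - exact: (pert_bounded hX hT t0_gt0 hV).
  - exact: (pert_ucb hX hT t0_gt0 hV).
  - exact: (pert_equi hX hT t0_gt0 hV).
  - exact: (pert0 hX hT t0_gt0 hV).
  - exact: (pert_add hX hT t0_gt0 hV).
pose w r := S r x - x - ofR K r *: y.
pose e r := T r (x + C x) - (x + C x) - ofR K r *: y.
pose a := V (fun r => ofR K r *: y).
have zc : ucb P t0 (fun r => S r x - x).
  by apply: (ucbB hX) (ucb_cst hX _ _); exact: (pert_ucb hX hT t0_gt0 hV).
have wc : ucb P t0 w by apply: (ucbB hX) zc (ucb_ramp y).
have t00 : 0 <= t0 <= t0 by rewrite lexx ltW.
have ac : ucb P t0 a by apply: (cc_ucb hV) => //; exact: ucb_ramp.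
have ec : ucb P t0 e.
  by apply: (ucbB hX) (ucb_ramp y); apply: (ucbB hX) (ucb_cst hX _ _);
    exact: sg_orbit.
have wE r : 0 <= r <= t0 -> w r = (e r + a r) + V w r.
  move=> rt; have /andP[r0 rt'] := rt.
  rewrite /w (pert_increment x rt) (ccB hV rt (ucb_sub rt' zc) (ucb_sub rt' (ucb_ramp y))).
  by rewrite -/(a r) /e; lincomb.
rewrite (generator_expansion _ _ hS) -hgen (generator_expansion _ _ hT).
have -> : tau_little_o (fun r => sg_ext t0 S r x - x - ofR K r *: y) <-> tau_little_o w.
  have loc r : 0 <= r <= t0 -> sg_ext t0 S r x = S r x.
    move=> rt; apply: sg_ext_local => //; last exact: (pert_add hX hT t0_gt0 hV).
    exact: (pert0 hX hT t0_gt0 hV).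
  by split; apply: tau_little_o_ext => r rt; rewrite loc.
split=> [wo|eo].
  apply: tau_little_o_ext (tau_little_oB (tau_little_oB wo (V_ramp_little_o y))
    (cc_little_o wc wo)) => r rt.
  by rewrite wE// -/(a r) /e; lincomb.
apply: (fixpoint_little_o _ wc wE); first exact: (ucbD hX).
by apply: tau_little_oD => //; exact: V_ramp_little_o.
Qed.

End generator.

(** * The extrapolation space as a copy of X *)

Section transport.
Variables (R : realType) (K : scalars R) (X : completeNormedModType K).
Variables (P : set (X -> R)) (A : X -> X -> Prop) (E : extrapolation A).
Implicit Types (x : X) (y : eX1 E) (g : R -> X).

Lemma eA_injective : injective (eA E).
Proof.
move=> x x' xy; apply/eqP; rewrite -subr_eq0; apply/eqP/nrm0_eq0.
by rewrite -(eA_norm E) linearB/= xy subrr nrm0.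
Qed.

Lemma eAK : cancel (eA E) (@eA_inv _ _ _ _ E).
Proof.
by move=> x; apply: xget_unique => // x'; exact: eA_injective.
Qed.

Lemma eA_invK : cancel (@eA_inv _ _ _ _ E) (eA E).
Proof.
move=> y; have : range (@ei1 _ _ _ _ E) (ei1 E y) by exists y.
rewrite ei1_range => -[x _ /=]; rewrite -eA_restr => /(@ei1_inj _ _ _ _ E) <-.
by rewrite eAK.
Qed.

Lemma eA_inv_linear : linear (@eA_inv _ _ _ _ E).
Proof. by move=> a y y'; apply: eA_injective; rewrite linearP !eA_invK. Qed.

Lemma nrm_eA_inv y : nrm (@eA_inv _ _ _ _ E y) = nrm y.
Proof. by rewrite -[in RHS](eA_invK y) eA_norm. Qed.

Lemma tau_nbhs_eA x (U : set (eX1 E)) :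
  tau_nbhs (P1 P (E := E)) (eA E x) U <-> tau_nbhs P x (eA E @^-1` U).
Proof.
split=> -[n [q [e [e0 Pq qU]]]].
  have lift i : exists p, P p /\ p \o @eA_inv _ _ _ _ E = q i.
    by have [p Pp pq] := Pq i; exists p.
  have [p hp] := choice lift.
  exists n, p, e; split=> // [i|y py]; first by have [] := hp i.
  apply: qU => i; have [_ <-] := hp i.
  by rewrite /= -linearB/= eAK.
exists n, (fun i => q i \o @eA_inv _ _ _ _ E), e; split=> // [i|y qy].
  by exists (q i).
rewrite -(eA_invK y); apply: qU => i; have := qy i.
by rewrite /= (linB eA_inv_linear) eAK.
Qed.

Lemma tau_integral_eA g (a b : R) x :
  is_tau_integral (P1 P (E := E)) (fun r => eA E (g r)) a b (eA E x) <->
  is_tau_integral P g a b x.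
Proof.
have sumE n (s xi : nat -> R) :
    \sum_(i < n) ofR K (s i.+1 - s i) *: eA E (g (xi i)) =
    eA E (\sum_(i < n) ofR K (s i.+1 - s i) *: g (xi i)).
  by rewrite linear_sum; apply: eq_bigr => i _; rewrite linearZ.
split=> h U PU.
  have [|d d0 hd] := h (@eA_inv _ _ _ _ E @^-1` U).
    apply/tau_nbhs_eA; move: PU; congr (tau_nbhs _ _ _); apply/seteqP.
    by split=> y /=; rewrite eAK.
  exists d => // n s xi sa sb hs; have := hd n s xi sa sb hs.
  by rewrite sumE /= eAK.
have [d d0 hd] := h _ ((tau_nbhs_eA x U).1 PU).
by exists d => // n s xi sa sb hs; rewrite sumE; exact: hd.
Qed.

End transport.

(** The resolvent at 0 is minus the inverse, which is therefore everywhere defined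
    and linear. *)
Lemma resolvent0_inv (R : realType) (K : scalars R) (X : completeNormedModType K)
    (A : X -> X -> Prop) : resolvent_set A 0 ->
  linear (graph_inv A) /\ forall x z, A x z <-> x = graph_inv A z.
Proof.
move=> [S [[lS _] hS]].
have AS x z : A x z <-> x = S (- z).
  rewrite -hS scale0r; split=> [Axz|[z' Axz]]; first by exists z => //; rewrite sub0r.
  by rewrite sub0r => /oppr_inj ->.
have JS z : graph_inv A z = S (- z).
  by apply: xget_unique => [|y /= /AS //]; apply/AS.
split=> [a x y|x z]; last by rewrite JS; exact: AS.
by rewrite !JS opprD -scalerN lS.
Qed.

Section function_spaces.
Variables (R : realType) (K : scalars R) (X : completeNormedModType K).
Variables (P : set (X -> R)) (hX : bicont_space P) (t0 : R).
Hypothesis t0_gt0 : 0 < t0.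
Implicit Types (x y : X) (F : R -> X -> X).

Lemma sup_on_le (g : R -> R) (a : R) : (forall r : R, 0 <= r <= t0 -> g r <= a) ->
  (sup_on t0 g <= a%:E)%E.
Proof.
move=> ga; apply: ge_ereal_sup => _ [r /= + <-]; rewrite in_itv/= lee_fin.
exact: ga.
Qed.

Lemma op_supnorm_leP F (c : R) : 0 <= c ->
  (forall t : R, 0 <= t <= t0 -> linear (F t)) ->
  (op_supnorm t0 F <= c%:E)%E <->
  forall (t : R) x, 0 <= t <= t0 -> nrm (F t x) <= c * nrm x.
Proof.
move=> c0 lF; split=> [h t x tt|h].
  apply: (opnorm_leP (lF t tt) c0).1; apply: le_trans h.
  by apply: ereal_sup_ubound; exists t => //; rewrite /= in_itv.
apply: ge_ereal_sup => _ [t /= + <-]; rewrite in_itv/= => tt.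
by apply/(opnorm_leP (lF t tt) c0) => x; exact: h.
Qed.

Lemma frakX_linear F (t : R) : frakX P t0 F -> 0 <= t <= t0 -> linear (F t).
Proof. by move=> [h _ _ _] tt; have [] := h t _; rewrite ?in_itv. Qed.

Lemma frakX_bounded F : frakX P t0 F -> exists2 c : R, 0 <= c &
  (op_supnorm t0 F <= c%:E)%E.
Proof.
move=> FX; have z0 : 0 <= (0 : R) <= t0 by rewrite lexx ltW.
have [_ _ Fb _] := FX; have s0 : (0 <= op_supnorm t0 F)%E.
  apply: le_trans (opnorm_ge0 (frakX_linear FX z0)) _.
  by apply: ereal_sup_ubound; exists 0 => //; rewrite /= in_itv.
exists (fine (op_supnorm t0 F)); first exact: fine_ge0.
by rewrite fineK// ge0_fin_numE.
Qed.

Lemma frakX_ucb F x : frakX P t0 F -> ucb P t0 (F ^~ x).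
Proof.
move=> FX; have [_ Fc _ _] := FX; have [c c0 hc] := frakX_bounded FX.
split; first by apply: (heine hX); apply/pcontP.
exists (c * nrm x) => t tt.
exact: (op_supnorm_leP c0 (fun t => frakX_linear FX)).1.
Qed.

End function_spaces.

(** * Admissibility and generation *)

Section admissibility.
Variables (R : realType) (K : scalars R) (X : completeNormedModType K).
Variables (P : set (X -> R)) (hX : bicont_space P).
Variables (T : R -> X -> X) (hT : bicont_semigroup P T) (t0 : R).
Hypothesis t0_gt0 : 0 < t0.

(** The seminorm bound of the contraction carries bi-equicontinuity from [F] to [V F],
    applied to the orbits of a null sequence. *)
Lemma cc_frakX (M : R) V F G : causal_contraction P T t0 M V ->
  frakX P t0 F ->
  (forall (t : R) x, 0 <= t <= t0 -> G t x = V (F ^~ x) t) -> frakX P t0 G.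
Proof.
move=> hV FX GV; have Fu x := frakX_ucb hX t0_gt0 x FX.
have M0 := ltW (cc_gt0 hV).
have sub (t : R) x : 0 <= t <= t0 -> ucb P t (F ^~ x).
  by move=> /andP[_ tt]; exact: ucb_sub (Fu x).
have t00 : 0 <= t0 <= t0 by rewrite lexx ltW.
have [c c0 Fc] := frakX_bounded t0_gt0 FX.
have Fn := (op_supnorm_leP c0 (fun t => frakX_linear FX)).1 Fc.
have lG t : 0 <= t <= t0 -> linear (G t).
  move=> tt a x y; rewrite !GV// -(cc_linear hV)//; try exact: sub.
  apply: (cc_ext hV); try exact: sub; first by case/andP: tt.
  move=> r /andP[r0 rt]; rewrite (frakX_linear FX)// r0 (le_trans rt)//.
  by case/andP: tt.
have Gn (t : R) x : 0 <= t <= t0 -> nrm (G t x) <= M * c * nrm x.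
  move=> tt; rewrite GV// -mulrA; apply: (cc_nrm hV) => //; first exact: sub.
  move=> r /andP[r0 rt]; apply: Fn; rewrite r0 (le_trans rt)//.
  by case/andP: tt.
have Mc : 0 <= M * c by rewrite mulr_ge0.
split.
- move=> t; rewrite in_itv/= => tt; apply/bounded_linearP; split; first exact: lG.
  by exists (M * c) => // x; exact: Gn.
- move=> x; apply/pcontP/ucont_p.
  have [] // : ucb P t0 (fun t => G t x).
  apply: ucb_ext (cc_ucb hV t00 (Fu x)) => t tt.
  by rewrite GV.
- apply: le_lt_trans (ltry (M * c)).
  exact: (op_supnorm_leP Mc lG).2.
- have [_ _ _ Fe] := FX.
  apply/bi_equicontinuousP => u ub u0 p e Pp e0; have [k uk] := ub.
  have k0 : 0 <= k by apply: le_trans (nrm_ge0 _) (uk 0%N).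
  have ck : 0 < c * k + 1 by rewrite ltr_wpDl// mulr_ge0.
  have e4 : 0 < e / 4 / (c * k + 1) by rewrite !divr_gt0.
  have [q [l [Pq l0 hq]]] := cc_sn hV e4 Pp.
  have [N hN] := (bi_equicontinuousP P _).1 Fe u ub u0 q (e / 4 / l) Pq
    ltac:(by rewrite !divr_gt0).
  exists N => n Nn _ [t /= + <-]; rewrite in_itv/= => tt; rewrite GV//.
  have := hq (F ^~ (u n)) t (e / 4 / l) (c * k) tt (sub _ _ tt) _ _.
  move=> h; apply: le_lt_trans (h _ _) _.
  + move=> r /andP[r0 rt]; apply/ltW/(hN n Nn); exists r => //=.
    by rewrite in_itv/= r0 (le_trans rt)//; case/andP: tt.
  + move=> r /andP[r0 rt]; apply: le_trans (Fn r _ _) _.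
      by rewrite r0 (le_trans rt)//; case/andP: tt.
    by rewrite ler_wpM2l.
  have -> : l * (e / 4 / l) = e / 4 by field; rewrite gt_eqF.
  have : e / 4 / (c * k + 1) * (c * k) <= e / 4.
    by rewrite mulrAC -mulrA ler_piMr//; [lra|rewrite ler_pdivrMr//; lra].
  lra.
Qed.

Lemma ctrl_contraction (J : X -> X) (lJ : linear J)
  (hgen : forall x z, generator P T x z <-> x = J z)
  (C : X -> X) (lC : linear C)
  (C_ucb : forall (b : R) f, ucb P b f -> ucb P b (C \o f)) (M : R) :
  0 < M -> M < 1 ->
  (forall f, ucb P t0 f -> exists y, sgconv P T C f t0 = J y) ->
  (forall (e : R) p, 0 < e -> P p -> exists q (k : R),
    [/\ P q, 0 < k & forall f y (a b : R), ucb P t0 f -> sgconv P T C f t0 = J y ->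
    (forall r : R, 0 <= r <= t0 -> q (f r) <= a) -> bdd_by t0 f b ->
    p y <= k * a + e * b]) ->
  (forall f y (b : R), ucb P t0 f -> sgconv P T C f t0 = J y ->
    bdd_by t0 f b -> nrm y <= M * b) ->
  causal_contraction P T t0 M (ctrl P T J C).
Proof.
move=> M0 M1 ha hb hc; split=> //.
- exact: (ctrl_ext hX hT).
- exact: (ctrlZD hX hT lJ hgen lC C_ucb ha).
- exact: (ucb_ctrl hX hT lJ hgen lC C_ucb ha hb hc).
- exact: (ctrl_nrm hX hT lJ hgen lC C_ucb ha hc).
- exact: (ctrl_sn hX hT lJ hgen lC C_ucb ha hb).
- exact: (ctrl_cat hX hT lJ hgen lC C_ucb ha).
Qed.

End admissibility.

Theorem theorem3p1 (R : realType) (K : scalars R)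
    (X : completeNormedModType K) (P : set (X -> R)) (hX : bicont_space P)
    (T : R -> X -> X) (hT : bicont_semigroup P T)
    (h0 : resolvent_set (generator P T) 0)
    (E : extrapolation (generator P T))
    (B : X -> eX1 E) (hB : bounded_tau_continuous P B)
    (t0 : R) (ht0 : 0 < t0)
    (ha : forall f, Cb P t0 f -> exists y, conv_integral P T B f t0 y)
    (hb : forall (e : R) (p : X -> R), 0 < e -> P p ->
       exists (q : X -> R) (k : R), [/\ P q, 0 < k &
         forall f y, Cb P t0 f -> conv_integral P T B f t0 y ->
           ((p y)%:E <= k%:E * sup_on t0 (fun r => `|q (f r)|)%R
                        + e%:E * sup_on t0 (fun r => nrm (f r))%R)%E])
    (hc : exists2 M : R, 0 < M < 2^-1 &
       forall f y, Cb P t0 f -> conv_integral P T B f t0 y ->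
         ((nrm y)%:E <= M%:E * sup_on t0 (fun r => nrm (f r))%R)%E) :
  DS_admissible P T t0 B /\ generates_bicont_semigroup P (perturbed B).
Proof.
have [lJ hgen] := resolvent0_inv h0.
set J := graph_inv (generator P T) in lJ hgen.
have [/bounded_linearP[lB [k k0 Bk]] Bc] := hB.
pose C := @eA_inv _ _ _ _ E \o B.
have BC x : B x = eA E (C x) by rewrite /C /= eA_invK.
have lC : linear C by move=> a x y; rewrite /C /= lB (eA_inv_linear (E := E)).
have C_ucb (b : R) f : ucb P b f -> ucb P b (C \o f).
  move=> [fc [c fb]]; split; last first.
    exists (k * c) => t tb; rewrite /C /= nrm_eA_inv.
    by apply: le_trans (Bk _) _; rewrite ler_wpM2l// fb.
  apply: (heine hX); apply/pcontP => t tb U PU.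
  have /Bc : tau_nbhs (P1 P (E := E)) (B (f t)) (@eA_inv _ _ _ _ E @^-1` U).
    rewrite BC; apply/tau_nbhs_eA; move: PU; congr (tau_nbhs _ _ _).
    by apply/seteqP; split=> y /=; rewrite eAK.
  exact: (pcontP P b f).2 (ucont_p fc) t tb _.
have convE (t : R) f y : 0 <= t -> ucb P t f ->
    conv_integral P T B f t y <-> sgconv P T C f t = J y.
  move=> tge0 fc; rewrite /conv_integral.
  have -> : (fun r => T1 T (t - r) (B (f r))) =
      (fun r => eA E (T (t - r) (C (f r)))) by [].
  rewrite tau_integral_eA -/J; split=> [|<-]; first exact: tau_integral_integ.
  by apply: (integP hX) => //; exact: ucb_conv.
have t00 : 0 <= t0 by exact: ltW.
have [M /andP[M0 M2] hM] := hc.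
have hV : causal_contraction P T t0 M (ctrl P T J C).
  apply: ctrl_contraction => //.
  - by move: M2; lra.
  - by move=> f fc; have [y hy] := ha f ((CbP hX _ _).2 fc); exists y; apply/convE.
  - move=> e p e0 Pp; have [q [l [Pq l0 hq]]] := hb e p e0 Pp.
    exists q, l; split=> // f y a b fc /convE fy fa fb.
    rewrite -lee_fin; apply: le_trans (hq f y ((CbP hX _ _).2 fc) (fy t00 fc)) _.
    rewrite EFinD !EFinM; apply: leeD; apply: lee_wpmul2l;
      rewrite ?lee_fin ?(ltW l0) ?(ltW e0)//.
      by apply: sup_on_le => r rt; rewrite ger0_norm ?fa// (sn_ge0 hX).
    exact: sup_on_le.
  - move=> f y b fc /convE fy fb.
    rewrite -lee_fin; apply: le_trans (hM f y ((CbP hX _ _).2 fc) (fy t00 fc)) _.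
    rewrite EFinM; apply: lee_wpmul2l; rewrite ?lee_fin ?(ltW M0)//.
    exact: sup_on_le.
split.
  have sub F (t : R) x : frakX P t0 F -> 0 <= t <= t0 -> ucb P t (F ^~ x).
    by move=> FX /andP[_ tt]; exact: ucb_sub (frakX_ucb hX ht0 x FX).
  have ctrl_conv F (t : R) x : frakX P t0 F -> 0 <= t <= t0 ->
      conv_integral P T B (F ^~ x) t (ctrl P T J C (F ^~ x) t).
    move=> FX tt; apply/convE; [by case/andP: tt|exact: sub|].
    apply: (ctrlP hX hT lJ hgen lC C_ucb _ tt (sub _ _ _ FX tt)) => f fc.
    by have [y hy] := ha f ((CbP hX _ _).2 fc); exists y; apply/convE.
  have graphE F G : frakX P t0 F -> V_graph P T B t0 F G ->
      forall (t : R) x, 0 <= t <= t0 -> G t x = ctrl P T J C (F ^~ x) t.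
    move=> FX FG t x tt; apply/esym/(ctrl_eq hX hgen).
    have /andP[tge0 _] := tt; apply/(convE t (F ^~ x) _ tge0 (sub _ _ _ FX tt)).
    by apply: FG; rewrite in_itv.
  split=> //.
  - move=> F t x FX; rewrite in_itv/= => tt; exists (ctrl P T J C (F ^~ x) t).
    exact: ctrl_conv.
  - by move=> F G FX /(graphE _ _ FX) GV; exact: (cc_frakX hX ht0 hV FX GV).
  apply: (@le_lt_trans _ _ M%:E); last by rewrite lte_fin; lra.
  apply: ge_ereal_sup => _ [F [G [FX F1 /(graphE _ _ FX) GV ->]]].
  have GX := cc_frakX hX ht0 hV FX GV.
  apply/(op_supnorm_leP (ltW M0) (fun t => frakX_linear GX)) => t x tt.
  have /andP[_ tt'] := tt.
  rewrite GV//; apply: (cc_nrm hV) => //; first exact: sub.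
  move=> r /andP[r0 rt]; rewrite -[leRHS]mul1r.
  apply: (op_supnorm_leP ler01 (fun t => frakX_linear FX)).1 => //.
  by rewrite r0 (le_trans rt).
exists (sg_ext t0 (pert P T t0 (ctrl P T J C))).
  apply: (bicont_semigroup_ext hX ht0).
  - exact: (pert_linear hX hT ht0 hV).
  - exact: (pert_bounded hX hT ht0 hV).
  - exact: (pert_ucb hX hT ht0 hV).
  - exact: (pert_equi hX hT ht0 hV).
  - exact: (pert0 hX hT ht0 hV).
  - exact: (pert_add hX hT ht0 hV).
move=> x y; rewrite (generator_pert hX ht0 hT hV lJ hgen); last 2 first.
- by move=> t z tge0; exact: ctrl_cst.
- by move=> t z tge0; exact: ctrl_ramp.
rewrite /perturbed BC -linearD /emb -/J; split=> [->//|].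
exact: (eA_injective (E := E)).
Qed.
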